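(* Let $m_1>0$ and $m_1\geq|m_2|$, and consider the Euler problem with fixed centers $e$ and $m$ of masses $m_1$ and $m_2$ respectively. If the energy $c$ is less than the critical value $c_0=-(\sqrt{m_1}+\sqrt{|m_2|})^2$, then the toric domain $X_{\Omega_{m_2}}$ defined for the bounded component around the fixed center $e$ of the regularized energy hypersurface is concave if $m_2\geq0$ and convex if $m_2\leq0$.
   Context: **Euler problem.** The Hamiltonian is $H_0(q,p)=\frac12|p|^2-U_0(q)$ with centers $e=(-\frac12,0)$, $m=(\frac12,0)$ and $$U_0(q)=\frac{m_1}{\sqrt{(q_1+\frac12)^2+q_2^2}}+\frac{m_2}{\sqrt{(q_1-\frac12)^2+q_2^2}} .$$ **Regularization.** Use elliptic coordinates $(\mu,\nu)\in\mathbb{R}\times S^1$, $S^1=\mathbb{R}/2\pi\mathbb{Z}$, with $q_1=\frac12\cosh\mu\cos\nu$, $q_2=\frac12\sinh\mu\sin\nu$ (so $e$ corresponds to $(\mu,\nu)=(0,\pi)$ and $m$ to $(0,0)$), together with the conjugate momenta $(p_\mu,p_\nu)$. Put $M_1=m_1+m_2$, $M_2=m_1-m_2$. The function $\frac14(\cosh^2\mu-\cos^2\nu)(H_0-c)$ extends smoothly to $K_{c,0}=K^1_{c,0}+K^2_{c,0}$ on $T^*(\mathbb{R}\times S^1)$, where $$K^1_{c,0}=\tfrac12p_\mu^2-\tfrac c4(\cosh^2\mu-1)-\tfrac{M_1}{2}\cosh\mu,\qquad K^2_{c,0}=\tfrac12p_\nu^2+\tfrac c4(\cos^2\nu-1)+\tfrac{M_2}{2}\cos\nu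 .$$ The regularized energy hypersurface is $\overline{\Sigma}_{c,0}=K_{c,0}^{-1}(0)$; its bounded component around $e$ is the bounded connected component $\overline{\Sigma}^e_{c,0}$ meeting the fibre over $(\mu,\nu)=(0,\pi)$. It is the union over $\kappa\in[-\frac{M_2}{2},\frac{M_1}{2}]$ of the products of the component of $\{K^1_{c,0}=-\kappa\}$ around $\mu=0$ and the component of $\{K^2_{c,0}=\kappa\}$ around $\nu=\pi$ (closed orbits, degenerating to points at the endpoints). **The toric domain $X_{\Omega_{m_2}}$.** Let $\tau^1_c(b)$ be the period of the closed orbit of $K^1_{c,0}$ at energy $b$ around $\mu=0$, and $\tau^2_c(b)$ the period of the closed orbit of $K^2_{c,0}$ at energy $b$ around $\nu=\pi$. Put $\mathcal{T}^1_c(s)=\int_{-M_1/2}^{s}\tau^1_c(b)\,db$ and $\mathcal{T}^2_c(s)=\int_{-M_2/2}^{s}\tau^2_c(b)\,db$. The image of the moment map is the curve $\{(\mathcal{T}^1_c(-\kappa),\mathcal{T}^2_c(\kappa)):\kappa\in[-\frac{M_2}{2},\frac{M_1}{2}]\}\subset[0,\infty)^2$, which is the graph of a strictly decreasing function $f$ on $[0,a]$ with $a=\mathcal{T}^1_c(\frac{M_2}{2})$ and $f(a)=0$. Let $\Omega_{m_2}=\{(\rho_1,\rho_2):0\le\rho_1\le a,\ 0\le\rho_2\le f(\rho_1)\}$ and $X_{\Omega_{m_2}}=\{z\in\mathbb{C}^2:(\pi|z_1|^2,\pi|z_2|^2)\in\Omega_{m_2}\}$. **Convex and concave.** A toric domain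 $X_\Omega$ is convex if $\hat\Omega=\{\mu\in\mathbb{R}^2:(|\mu_1|,|\mu_2|)\in\Omega\}$ is compact and convex. It is concave if $\Omega$ is the region in $[0,\infty)^2$ bounded by the coordinate axes and the graph of a convex decreasing function $f:[0,a]\to[0,\infty)$ with $f(a)=0$. *)

(* Defs.v *)
From Stdlib Require Import Reals Lra List.
From Coquelicot Require Import Coquelicot.
Open Scope R_scope.

(** ** The Euler problem and its regularization *)

Definition U0 (m1 m2 q1 q2 : R) : R :=
  m1 / sqrt ((q1 + 1/2)^2 + q2^2) + m2 / sqrt ((q1 - 1/2)^2 + q2^2).

Definition H0 (m1 m2 q1 q2 p1 p2 : R) : R :=
  1/2 * (p1^2 + p2^2) - U0 m1 m2 q1 q2.

Definition c0 (m1 m2 : R) : R := - (sqrt m1 + sqrt (Rabs m2))^2.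

Definition M1 (m1 m2 : R) : R := m1 + m2.
Definition M2 (m1 m2 : R) : R := m1 - m2.

Definition K1 (m1 m2 c mu pmu : R) : R :=
  1/2 * pmu^2 - c/4 * ((cosh mu)^2 - 1) - M1 m1 m2 / 2 * cosh mu.

Definition K2 (m1 m2 c nu pnu : R) : R :=
  1/2 * pnu^2 + c/4 * ((cos nu)^2 - 1) + M2 m1 m2 / 2 * cos nu.

Definition ell1 (mu nu : R) : R := 1/2 * cosh mu * cos nu.
Definition ell2 (mu nu : R) : R := 1/2 * sinh mu * sin nu.

(** [K1 + K2] is the regularization of [H0]: the hypotheses on the momenta say
    [(pmu, pnu) = (Dell)^T (p1, p2)], and the two inequalities exclude the
    collisions with the two centers. *)
Lemma regularization (m1 m2 c mu nu p1 p2 pmu pnu : R) :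
  pmu = 1/2 * sinh mu * cos nu * p1 + 1/2 * cosh mu * sin nu * p2 ->
  pnu = - (1/2 * cosh mu * sin nu) * p1 + 1/2 * sinh mu * cos nu * p2 ->
  cosh mu + cos nu <> 0 -> cosh mu - cos nu <> 0 ->
  1/4 * ((cosh mu)^2 - (cos nu)^2)
    * (H0 m1 m2 (ell1 mu nu) (ell2 mu nu) p1 p2 - c)
  = K1 m1 m2 c mu pmu + K2 m1 m2 c nu pnu.
Proof.
intros Hmu Hnu Hp Hm.
assert (Hs : (sin nu)^2 = 1 - (cos nu)^2).
{ generalize (sin2_cos2 nu); unfold Rsqr; nra. }
assert (Hsh : (sinh mu)^2 = (cosh mu)^2 - 1).
{ unfold sinh, cosh.
  assert (E : exp mu * exp (- mu) = 1)
    by (rewrite <- exp_plus, Rplus_opp_r; apply exp_0).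
  nra. }
assert (Hch : 1 <= cosh mu).
{ assert (0 < cosh mu)
    by (unfold cosh; generalize (exp_pos mu) (exp_pos (- mu)); lra).
  generalize (pow2_ge_0 (sinh mu)); nra. }
generalize (COS_bound nu); intros [Hc1 Hc2].
assert (He : sqrt ((ell1 mu nu + 1/2)^2 + (ell2 mu nu)^2)
             = 1/2 * (cosh mu + cos nu)).
{ apply sqrt_lem_1; [apply Rplus_le_le_0_compat; apply pow2_ge_0 | lra |].
  unfold ell1, ell2.
  replace ((1/2 * sinh mu * sin nu)^2)
    with (1/4 * (sinh mu)^2 * (sin nu)^2) by field.
  rewrite Hs, Hsh; field. }
assert (Hd : sqrt ((ell1 mu nu - 1/2)^2 + (ell2 mu nu)^2)
             = 1/2 * (cosh mu - cos nu)).
{ apply sqrt_lem_1; [apply Rplus_le_le_0_compat; apply pow2_ge_0 | lra |].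
  unfold ell1, ell2.
  replace ((1/2 * sinh mu * sin nu)^2)
    with (1/4 * (sinh mu)^2 * (sin nu)^2) by field.
  rewrite Hs, Hsh; field. }
assert (Hkin : pmu^2 + pnu^2
               = 1/4 * ((cosh mu)^2 - (cos nu)^2) * (p1^2 + p2^2)).
{ subst pmu pnu.
  transitivity (1/4 * ((sinh mu)^2 * (cos nu)^2 + (cosh mu)^2 * (sin nu)^2)
                * (p1^2 + p2^2)); [field |].
  rewrite Hs, Hsh; field. }
unfold H0, U0, K1, K2, M1, M2; rewrite He, Hd.
transitivity (1/2 * (pmu^2 + pnu^2)
  - 1/2 * (m1 * (cosh mu - cos nu) + m2 * (cosh mu + cos nu))
  - c/4 * ((cosh mu)^2 - (cos nu)^2)).
- rewrite Hkin; field; split; assumption.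
- field.
Qed.

(** ** Periods of closed orbits *)

Definition hamiltonian_trajectory (H : R -> R -> R) (q p : R -> R) : Prop :=
  forall t : R,
    is_derive q t (Derive (fun y => H (q t) y) (p t)) /\
    is_derive p t (- Derive (fun x => H x (p t)) (q t)).

(** A position on the circle R/2piZ is represented by any of its real lifts. *)
Definition eq_circle (x y : R) : Prop :=
  exists k : Z, x = y + 2 * PI * IZR k.

(** [T] is a period of a trajectory of energy [b] that starts on the fibre over
    [x0]; [eqQ] is equality of positions ([eq] on the line, [eq_circle] on the
    circle).  The closed orbit around [x0] at energy [b] is the component of
    the level set [H = b] that meets the fibre over [x0], so up to a time shift
    (which does not change periods) it is parametrized by such a trajectory. *)
Definition orbit_period (eqQ : R -> R -> Prop) (H : R -> R -> R) (x0 b T : R)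
  : Prop :=
  0 < T /\
  exists q p : R -> R,
    hamiltonian_trajectory H q p /\
    q 0 = x0 /\ H (q 0) (p 0) = b /\
    forall t : R, eqQ (q (t + T)) (q t) /\ p (t + T) = p t.

(** The minimal period.  At the bottom energy, where the orbit is a point, this
    takes the value 0; that single value does not affect the integrals below. *)
Definition period (eqQ : R -> R -> Prop) (H : R -> R -> R) (x0 b : R) : R :=
  real (Glb_Rbar (orbit_period eqQ H x0 b)).

Definition tau1 (m1 m2 c b : R) : R := period eq (K1 m1 m2 c) 0 b.
Definition tau2 (m1 m2 c b : R) : R := period eq_circle (K2 m1 m2 c) PI b.

Definition T1 (m1 m2 c s : R) : R :=
  RInt (tau1 m1 m2 c) (- M1 m1 m2 / 2) s.
Definition T2 (m1 m2 c s : R) : R :=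
  RInt (tau2 m1 m2 c) (- M2 m1 m2 / 2) s.

(** ** Toric domains *)

Definition toric_domain (Omega : R * R -> Prop) (z : C * C) : Prop :=
  Omega (PI * (Cmod (fst z))^2, PI * (Cmod (snd z))^2).

Definition in_quadrant (Omega : R * R -> Prop) : Prop :=
  forall rho, Omega rho -> 0 <= fst rho /\ 0 <= snd rho.

Definition compact_set {X : UniformSpace} (A : X -> Prop) : Prop :=
  forall (I : Type) (U : I -> X -> Prop),
    (forall i, open (U i)) ->
    (forall x, A x -> exists i, U i x) ->
    exists l : list I, forall x, A x -> exists i, In i l /\ U i x.

Definition convex_set (A : R * R -> Prop) : Prop :=
  forall (x y : R * R) (t : R), A x -> A y -> 0 <= t <= 1 ->
    A (t * fst x + (1 - t) * fst y, t * snd x + (1 - t) * snd y).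

Definition convex_on (a b : R) (f : R -> R) : Prop :=
  forall x y t : R, a <= x <= b -> a <= y <= b -> 0 <= t <= 1 ->
    f (t * x + (1 - t) * y) <= t * f x + (1 - t) * f y.

Definition decreasing_on (a b : R) (f : R -> R) : Prop :=
  forall x y : R, a <= x -> x < y -> y <= b -> f y < f x.

Definition hat (Omega : R * R -> Prop) (mu : R * R) : Prop :=
  Omega (Rabs (fst mu), Rabs (snd mu)).

(** A region of the quadrant is determined by its toric domain, so quantifying
    existentially over [Omega] here is harmless. *)
Definition convex_toric_domain (X : C * C -> Prop) : Prop :=
  exists Omega : R * R -> Prop,
    in_quadrant Omega /\ (forall z, X z <-> toric_domain Omega z) /\
    compact_set (X := prod_UniformSpace R_UniformSpace R_UniformSpace)
      (hat Omega) /\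
    convex_set (hat Omega).

Definition concave_toric_domain (X : C * C -> Prop) : Prop :=
  exists Omega : R * R -> Prop,
    in_quadrant Omega /\ (forall z, X z <-> toric_domain Omega z) /\
    exists (a : R) (f : R -> R),
      0 < a /\
      (forall x, 0 <= x <= a -> 0 <= f x) /\ f a = 0 /\
      convex_on 0 a f /\ decreasing_on 0 a f /\
      forall x y : R, Omega (x, y) <-> 0 <= x <= a /\ 0 <= y <= f x.

Definition moment_curve (m1 m2 c : R) (rho : R * R) : Prop :=
  exists kappa : R,
    - M2 m1 m2 / 2 <= kappa <= M1 m1 m2 / 2 /\
    rho = (T1 m1 m2 c (- kappa), T2 m1 m2 c kappa).

(** The region under the moment curve: since that curve is the graph of a
    function [f], the [y] below is [f (fst rho)]. *)
Definition Omega_e (m1 m2 c : R) (rho : R * R) : Prop :=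
  0 <= fst rho <= T1 m1 m2 c (M2 m1 m2 / 2) /\
  exists y : R, moment_curve m1 m2 c (fst rho, y) /\ 0 <= snd rho <= y.

(* Main.v *)
Require Import Defs.
From Stdlib Require Import Reals Lra Lia List.
From Stdlib Require Import Classical ClassicalEpsilon Ranalysis5.
From Coquelicot Require Import Coquelicot.
Open Scope R_scope.

(** Write [E = - c].  The moment curve has velocity [- tau1 (- kappa)] in the
    first coordinate and [tau2 kappa] in the second, so the shape of the domain
    is decided by the monotonicity of [tau2 kappa / tau1 (- kappa)].

    Both periods are values of one function.  In the coordinates
    [v = tanh (mu / 2)] and [v = tan ((nu - PI) / 2)] the two equations of motion
    become Duffing equations [4 v'^2 = A - 2 B v^2 - C v^4] with
    [B = E - 2 kappa], where [A, C] are [M1 - 2 kappa, M1 + 2 kappa] for [K1]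
    and [M2 + 2 kappa, M2 - 2 kappa] for [K2].  With [D = sqrt (B^2 + A C)] and
    [v = sqrt (A / (B + D)) sin th] the motion is that of a clock,
    [th' = sqrt ((B + D) cos^2 th + 2 D sin^2 th) / 2], which only sees [A] and
    [C] through [D = sqrt (E^2 - 4 E kappa + M^2)].  Hence both periods are
    [orbit_time E M kappa], with [M = M1] and [M = M2] ([tau1_orbit_time],
    [tau2_orbit_time]); they are minimal because a trajectory is determined by
    its initial condition ([newton_unique], [period_newton]).

    It remains to see that the logarithmic derivative of [orbit_time E M kappa]
    in [kappa] decreases when [M] grows ([orbit_time_log_slope]).  It is a sum
    of two ratios of elliptic integrals, both antitone in [D] for fixed [B]: one
    by pointwise comparison of the integrands ([ell_sin_antitone]), the other by
    an integration by parts that turns it into a mean value of [sin^2 th],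
    compared by Chebyshev's correlation inequality ([ell_cos_antitone]).  Since
    [M2 <= M1] when [0 <= m2] and [M1 <= M2] when [m2 <= 0], the slope of the
    moment curve is monotone in the required direction; the curve then lies on
    one side of its tangents ([tangent_side]), which gives a convex function in
    the first case and an intersection of half-planes in the second. *)

(** * Elliptic integrals *)

(** This is [(w + d) * (cos x)^2 + 2 * d * (sin x)^2]; [w] and [d] are the
    parameters in which the monotonicity below is expressed. *)
Definition quad (w d x : R) : R := w * (cos x)^2 + d * (1 + (sin x)^2).

Lemma cos_sq (x : R) : (cos x)^2 = 1 - (sin x)^2.
Proof. generalize (sin2_cos2 x); unfold Rsqr; lra. Qed.

Lemma sin_sq_bound (x : R) : 0 <= (sin x)^2 <= 1.
Proof.
split; [apply pow2_ge_0 |].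
generalize (cos_sq x) (pow2_ge_0 (cos x)); lra.
Qed.

Lemma quad_pos (w d x : R) : 0 < w -> 0 < d -> 0 < quad w d x.
Proof.
intros Hw Hd; unfold quad.
generalize (pow2_ge_0 (cos x)) (pow2_ge_0 (sin x)); intros; nra.
Qed.

Lemma quad_le (w d x : R) : 0 < w -> 0 < d -> quad w d x <= w + 2 * d.
Proof.
intros Hw Hd; unfold quad.
rewrite cos_sq; generalize (sin_sq_bound x); intros; nra.
Qed.

Definition ell (w d : R) : R :=
  RInt (fun x => 2 / sqrt (quad w d x)) 0 (2 * PI).

Lemma ex_RInt_derivable (f : R -> R) (a b : R) :
  (forall x, ex_derive f x) -> ex_RInt f a b.
Proof.
intros Hf; apply (ex_RInt_continuous (V := R_CompleteNormedModule)).
intros x _; apply (ex_derive_continuous f), Hf.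
Qed.

Lemma is_derive_quad (w d x : R) :
  is_derive (quad w d) x (2 * (d - w) * sin x * cos x).
Proof. unfold quad; auto_derive; [easy | ring]. Qed.

(* Differentiability in [x] of quotients by [quad w d x] and its root. *)
Ltac derive_quad :=
  match goal with
  | Hw : 0 < ?w, Hd : 0 < ?d |- @ex_derive _ _ _ ?x =>
    let H := fresh in
    assert (H := quad_pos w d x Hw Hd);
    auto_derive;
    repeat split;
    try (exists (2 * (d - w) * sin x * cos x); apply is_derive_quad);
    try assumption;
    try (apply Rgt_not_eq;
         repeat apply Rmult_lt_0_compat; try apply sqrt_lt_R0; assumption)
  end.

Lemma ex_RInt_quad_inv (w d a b : R) :
  0 < w -> 0 < d -> ex_RInt (fun x => 2 / sqrt (quad w d x)) a b.
Proof. intros Hw Hd; apply ex_RInt_derivable; intros x; derive_quad. Qed.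

Lemma ex_RInt_quad_inv_sin2 (w d a b : R) :
  0 < w -> 0 < d -> ex_RInt (fun x => (sin x)^2 / sqrt (quad w d x)) a b.
Proof. intros Hw Hd; apply ex_RInt_derivable; intros x; derive_quad. Qed.

Lemma ex_RInt_quad_cos2 (w d a b : R) :
  0 < w -> 0 < d ->
  ex_RInt (fun x => (cos x)^2 / (quad w d x * sqrt (quad w d x))) a b.
Proof. intros Hw Hd; apply ex_RInt_derivable; intros x; derive_quad. Qed.

Lemma ex_RInt_quad_sin2 (w d a b : R) :
  0 < w -> 0 < d ->
  ex_RInt (fun x => (1 + (sin x)^2) / (quad w d x * sqrt (quad w d x))) a b.
Proof. intros Hw Hd; apply ex_RInt_derivable; intros x; derive_quad. Qed.

Definition ell_cos (w d : R) : R :=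
  RInt (fun x => (cos x)^2 / (quad w d x * sqrt (quad w d x))) 0 (2 * PI).

Definition ell_sin (w d : R) : R :=
  RInt (fun x => (1 + (sin x)^2) / (quad w d x * sqrt (quad w d x)))
    0 (2 * PI).

Lemma RInt_lin (f g : R -> R) (u v a b : R) :
  ex_RInt f a b -> ex_RInt g a b ->
  RInt (fun x => u * f x + v * g x) a b = u * RInt f a b + v * RInt g a b.
Proof.
intros Hf Hg; apply is_RInt_unique.
apply (is_RInt_plus (V := R_NormedModule));
  apply (is_RInt_scal (V := R_NormedModule));
  apply (RInt_correct (V := R_CompleteNormedModule)); assumption.
Qed.

Lemma ex_RInt_lin (f g : R -> R) (u v a b : R) :
  ex_RInt f a b -> ex_RInt g a b -> ex_RInt (fun x => u * f x + v * g x) a b.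
Proof.
intros Hf Hg; apply (ex_RInt_plus (V := R_NormedModule));
  apply (ex_RInt_scal (V := R_NormedModule)); assumption.
Qed.

Lemma RInt_mult_l (f : R -> R) (u a b : R) :
  ex_RInt f a b -> RInt (fun x => u * f x) a b = u * RInt f a b.
Proof.
intros Hf; apply is_RInt_unique, (is_RInt_scal (V := R_NormedModule)).
apply (RInt_correct (V := R_CompleteNormedModule)), Hf.
Qed.

Lemma ex_RInt_mult_l (f : R -> R) (u a b : R) :
  ex_RInt f a b -> ex_RInt (fun x => u * f x) a b.
Proof. intros Hf; apply (ex_RInt_scal (V := R_NormedModule)), Hf. Qed.

Lemma two_PI_pos : 0 < 2 * PI.
Proof. generalize PI_RGT_0; lra. Qed.

Lemma ell_pos (w d : R) : 0 < w -> 0 < d -> 0 < ell w d.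
Proof.
intros Hw Hd; apply RInt_gt_0; [apply two_PI_pos | |].
- intros x _; apply Rdiv_lt_0_compat; [lra |].
  apply sqrt_lt_R0, quad_pos; assumption.
- intros x _.
  apply (ex_derive_continuous (fun t => 2 / sqrt (quad w d t))); derive_quad.
Qed.

(** The integrand on the left minus the one on the right is the derivative of
    the periodic function [sin x * cos x / sqrt (quad w d x)]. *)
Lemma ell_cos_by_parts (w d : R) : 0 < w -> 0 < d ->
  (w + d) * ell_cos w d
  = RInt (fun x => (sin x)^2 / sqrt (quad w d x)) 0 (2 * PI).
Proof.
intros Hw Hd.
set (g x := (w + d) * ((cos x)^2 / (quad w d x * sqrt (quad w d x)))
            + (-1) * ((sin x)^2 / sqrt (quad w d x))).
assert (Hg : is_RInt g 0 (2 * PI) 0).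
{ replace 0 with (minus (sin (2 * PI) * cos (2 * PI) / sqrt (quad w d (2 * PI)))
                    (sin 0 * cos 0 / sqrt (quad w d 0))) at 2
    by (rewrite sin_2PI, sin_0; unfold minus, plus, opp; simpl;
        unfold Rdiv; ring).
  apply (is_RInt_derive (fun x => sin x * cos x / sqrt (quad w d x))).
  - intros x _.
    assert (Hq := quad_pos w d x Hw Hd); assert (Hs := sqrt_lt_R0 _ Hq).
    assert (Dq := is_derive_quad w d x).
    auto_derive.
    + repeat split; try assumption; [eexists; apply Dq | lra].
    + replace (Derive (fun t => quad w d t) x)
        with (2 * (d - w) * sin x * cos x)
        by (symmetry; apply is_derive_unique, Dq).
      unfold g.
      set (r := sqrt (quad w d x)) in *.
      assert (Hr : quad w d x = r * r)
        by (symmetry; apply sqrt_sqrt; lra).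
      rewrite Hr; field_simplify_eq; [| lra].
      replace (r ^ 2) with (quad w d x) by (rewrite Hr; ring).
      unfold quad; rewrite cos_sq; ring.
  - intros x _; apply (ex_derive_continuous g); unfold g; derive_quad. }
apply (is_RInt_unique (V := R_CompleteNormedModule)) in Hg.
unfold g in Hg; rewrite RInt_lin in Hg.
- unfold ell_cos; lra.
- apply ex_RInt_quad_cos2; assumption.
- apply ex_RInt_quad_inv_sin2; assumption.
Qed.

Lemma quad_at (w d x : R) :
  quad w d x = w * (1 - (sin x)^2) + d * (1 + (sin x)^2).
Proof. unfold quad; rewrite cos_sq; reflexivity. Qed.

(** Chebyshev's correlation inequality: as [d] decreases, the weight
    [1 / sqrt (quad w d x)] is shifted towards large values of [(sin x)^2],
    since the ratio of two such weights is a monotone function of [(sin x)^2].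
    Subtracting the right multiple [r] of the first weight from the second
    gives a function that is nonpositive where [(sin x)^2] is below its mean for
    the first weight, and nonnegative where it is above. *)
Lemma mean_sin2_antitone (w d1 d2 : R) : 0 < w -> 0 < d2 -> d2 <= d1 ->
  RInt (fun x => (sin x)^2 / sqrt (quad w d1 x)) 0 (2 * PI) * ell w d2
  <= RInt (fun x => (sin x)^2 / sqrt (quad w d2 x)) 0 (2 * PI) * ell w d1.
Proof.
intros Hw Hd2 Hd; assert (Hd1 : 0 < d1) by lra.
assert (P := two_PI_pos).
assert (I1 := ell_pos w d1 Hw Hd1).
set (u d := RInt (fun x => (sin x)^2 / sqrt (quad w d x)) 0 (2 * PI)).
assert (Eu : forall d, 0 < d ->
   ex_RInt (fun x => (sin x)^2 / sqrt (quad w d x)) 0 (2 * PI))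
  by (intros; apply ex_RInt_quad_inv_sin2; assumption).
assert (Ee : forall d, 0 < d ->
   ex_RInt (fun x => 2 / sqrt (quad w d x)) 0 (2 * PI))
  by (intros; apply ex_RInt_quad_inv; assumption).
(* [ell] carries a factor 2, so [m] below is half the mean. *)
set (m := u d1 / ell w d1).
assert (Hm : 0 <= 2 * m <= 1).
{ assert (0 <= u d1).
  { apply RInt_ge_0; [lra | apply Eu; assumption |].
    intros x _; apply Rdiv_le_0_compat; [apply pow2_ge_0 |].
    apply sqrt_lt_R0, quad_pos; assumption. }
  assert (2 * u d1 <= ell w d1).
  { unfold u, ell.
    rewrite <- RInt_mult_l by auto.
    apply RInt_le; [lra | apply ex_RInt_mult_l; auto | auto |].
    intros x _.
    assert (Hs := sqrt_lt_R0 _ (quad_pos w d1 x Hw Hd1)).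
    apply (Rmult_le_reg_r (sqrt (quad w d1 x))); [assumption |].
    field_simplify; [| lra | lra]. generalize (sin_sq_bound x); lra. }
  split.
  - apply Rmult_le_pos; [lra |]; apply Rdiv_le_0_compat; assumption.
  - unfold m; apply (Rmult_le_reg_r (ell w d1)); [assumption |].
    field_simplify; lra. }
set (n d := w * (1 - 2 * m) + d * (1 + 2 * m)).
assert (Hn : forall d, 0 < d -> 0 < n d) by (intros; unfold n; nra).
set (r := sqrt (n d1) / sqrt (n d2)).
assert (K : 0 <= RInt (fun x =>
   1 * (1 * ((sin x)^2 / sqrt (quad w d2 x))
        + (- m) * (2 / sqrt (quad w d2 x)))
   + (- r) * (1 * ((sin x)^2 / sqrt (quad w d1 x))
              + (- m) * (2 / sqrt (quad w d1 x)))) 0 (2 * PI)).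
{ apply RInt_ge_0; [lra | apply ex_RInt_lin; apply ex_RInt_lin; auto |].
  intros x _.
  assert (H1 := quad_pos w d1 x Hw Hd1).
  assert (H2 := quad_pos w d2 x Hw Hd2).
  assert (S1 := sqrt_lt_R0 _ H1); assert (S2 := sqrt_lt_R0 _ H2).
  assert (T1 := sqrt_lt_R0 _ (Hn d1 Hd1)).
  assert (T2 := sqrt_lt_R0 _ (Hn d2 Hd2)).
  assert (C : 0 <= ((sin x)^2 - 2 * m) *
     (sqrt (quad w d1 x) * sqrt (n d2) - sqrt (n d1) * sqrt (quad w d2 x))).
  { rewrite <- !sqrt_mult by (apply Rlt_le; auto).
    assert (Q : quad w d1 x * n d2 - n d1 * quad w d2 x
                = 2 * w * (d1 - d2) * ((sin x)^2 - 2 * m))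
      by (rewrite !quad_at; unfold n; ring).
    destruct (Rle_dec (2 * m) ((sin x)^2)) as [L | L].
    - assert (sqrt (n d1 * quad w d2 x) <= sqrt (quad w d1 x * n d2)).
      { apply sqrt_le_1_alt.
        assert (0 <= 2 * w * (d1 - d2) * ((sin x)^2 - 2 * m)); [| lra].
        repeat apply Rmult_le_pos; lra. }
      apply Rmult_le_pos; lra.
    - assert (sqrt (quad w d1 x * n d2) <= sqrt (n d1 * quad w d2 x)).
      { apply sqrt_le_1_alt.
        assert (0 <= 2 * w * (d1 - d2) * (2 * m - (sin x)^2)); [| nra].
        repeat apply Rmult_le_pos; lra. }
      nra. }
  replace (1 * _ + - r * _) with
    (((sin x)^2 - 2 * m) *
     (sqrt (quad w d1 x) * sqrt (n d2) - sqrt (n d1) * sqrt (quad w d2 x))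
     / (sqrt (quad w d1 x) * sqrt (quad w d2 x) * sqrt (n d2))).
  - apply Rdiv_le_0_compat; [exact C |].
    repeat apply Rmult_lt_0_compat; assumption.
  - unfold r; field; lra. }
rewrite RInt_lin in K by (apply ex_RInt_lin; auto).
rewrite !RInt_lin in K by auto.
fold (u d1) (u d2) (ell w d1) (ell w d2) in K; fold (u d1) (u d2).
replace (u d1) with (m * ell w d1) in K |- * by (unfold m; field; lra).
nra.
Qed.

(** [ell_cos / ell] is [1 / (2 * (w + d))] times the mean of [(sin x)^2]. *)
Lemma ell_cos_antitone (w d1 d2 : R) : 0 < w -> 0 < d2 -> d2 <= d1 ->
  ell_cos w d1 * ell w d2 <= ell_cos w d2 * ell w d1.
Proof.
intros Hw Hd2 Hd; assert (Hd1 : 0 < d1) by lra.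
assert (H := mean_sin2_antitone w d1 d2 Hw Hd2 Hd).
rewrite <- !ell_cos_by_parts in H by assumption.
assert (I1 := ell_pos w d1 Hw Hd1); assert (I2 := ell_pos w d2 Hw Hd2).
assert (C2 : 0 <= ell_cos w d2).
{ apply RInt_ge_0; [generalize two_PI_pos; lra | |].
  - apply ex_RInt_quad_cos2; assumption.
  - intros x _; assert (Hq := quad_pos w d2 x Hw Hd2).
    apply Rdiv_le_0_compat; [apply pow2_ge_0 |].
    apply Rmult_lt_0_compat; [| apply sqrt_lt_R0]; assumption. }
apply (Rmult_le_reg_l (w + d1)); [lra |].
assert (0 <= ell_cos w d2 * ell w d1) by (apply Rmult_le_pos; lra).
nra.
Qed.

(** Multiplying [ell] by [sqrt d] and [ell_sin] by [1 / sqrt d] makes the two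
    integrands monotone in [d], in opposite directions. *)
Lemma ell_sin_antitone (w d1 d2 : R) : 0 < w -> 0 < d2 -> d2 <= d1 ->
  ell_sin w d1 / d1 * ell w d2 <= ell_sin w d2 / d2 * ell w d1.
Proof.
intros Hw Hd2 Hd; assert (Hd1 : 0 < d1) by lra.
assert (P := two_PI_pos).
assert (R1 := sqrt_lt_R0 _ Hd1); assert (R2 := sqrt_lt_R0 _ Hd2).
assert (R12 := sqrt_le_1_alt _ _ Hd).
assert (Q1 := fun x => quad_pos w d1 x Hw Hd1).
assert (Q2 := fun x => quad_pos w d2 x Hw Hd2).
assert (Q12 : forall x, quad w d2 x <= quad w d1 x).
{ intros x; unfold quad; generalize (pow2_ge_0 (sin x)); nra. }
assert (X1 : sqrt d2 * ell w d2 <= sqrt d1 * ell w d1).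
{ unfold ell.
  rewrite <- !RInt_mult_l by (apply ex_RInt_quad_inv; assumption).
  apply RInt_le; try apply ex_RInt_mult_l; try apply ex_RInt_quad_inv;
    try assumption; [lra |].
  intros x _.
  assert (S1 := sqrt_lt_R0 _ (Q1 x)); assert (S2 := sqrt_lt_R0 _ (Q2 x)).
  assert (L : sqrt d2 * sqrt (quad w d1 x) <= sqrt d1 * sqrt (quad w d2 x)).
  { rewrite <- !sqrt_mult by (apply Rlt_le; auto).
    apply sqrt_le_1_alt; unfold quad.
    assert (0 <= w * (cos x)^2) by (generalize (pow2_ge_0 (cos x)); nra).
    nra. }
  apply (Rmult_le_reg_r (sqrt (quad w d1 x) * sqrt (quad w d2 x))); [nra |].
  field_simplify; lra. }
assert (X2 : / sqrt d1 * ell_sin w d1 <= / sqrt d2 * ell_sin w d2).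
{ unfold ell_sin.
  rewrite <- !RInt_mult_l by (apply ex_RInt_quad_sin2; assumption).
  apply RInt_le; try apply ex_RInt_mult_l; try apply ex_RInt_quad_sin2;
    try assumption; [lra |].
  intros x _.
  assert (S1 := sqrt_lt_R0 _ (Q1 x)); assert (S2 := sqrt_lt_R0 _ (Q2 x)).
  assert (S12 := sqrt_le_1_alt _ _ (Q12 x)).
  assert (V1 := Q1 x); assert (V2 := Q2 x); assert (V12 := Q12 x).
  assert (0 < 1 + (sin x)^2) by (generalize (pow2_ge_0 (sin x)); lra).
  apply Rmult_le_compat.
  - apply Rlt_le, Rinv_0_lt_compat; assumption.
  - apply Rlt_le, Rdiv_lt_0_compat; [assumption | nra].
  - apply Rinv_le_contravar; assumption.
  - apply Rmult_le_compat_l; [lra |].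
    apply Rinv_le_contravar; [nra |].
    apply Rmult_le_compat; lra. }
assert (I2 := ell_pos w d2 Hw Hd2).
assert (0 <= / sqrt d1 * ell_sin w d1).
{ apply Rmult_le_pos; [apply Rlt_le, Rinv_0_lt_compat; assumption |].
  apply RInt_ge_0; [lra | apply ex_RInt_quad_sin2; assumption |].
  intros x _; apply Rdiv_le_0_compat;
    [generalize (pow2_ge_0 (sin x)); lra |].
  apply Rmult_lt_0_compat; [| apply sqrt_lt_R0]; auto. }
assert (X := Rmult_le_compat _ _ _ _ H
               (Rmult_le_pos _ _ (Rlt_le _ _ R2) (Rlt_le _ _ I2)) X2 X1).
assert (Y1 := sqrt_sqrt d1 (Rlt_le _ _ Hd1)).
assert (Y2 := sqrt_sqrt d2 (Rlt_le _ _ Hd2)).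
apply (Rmult_le_reg_l (sqrt d1 * sqrt d2)); [nra |].
replace (ell_sin w d1 / d1) with (ell_sin w d1 / (sqrt d1 * sqrt d1))
  by (rewrite Y1; reflexivity).
replace (ell_sin w d2 / d2) with (ell_sin w d2 / (sqrt d2 * sqrt d2))
  by (rewrite Y2; reflexivity).
replace (sqrt d1 * sqrt d2 * (ell_sin w d1 / (sqrt d1 * sqrt d1) * ell w d2))
  with (/ sqrt d1 * ell_sin w d1 * (sqrt d2 * ell w d2)) by (field; lra).
replace (sqrt d1 * sqrt d2 * (ell_sin w d2 / (sqrt d2 * sqrt d2) * ell w d1))
  with (/ sqrt d2 * ell_sin w d2 * (sqrt d1 * ell w d1)) by (field; lra).
exact X.
Qed.

(** * The period as a function of the energy *)

(** [(E - 2 * k)^2 + (M - 2 * k) * (M + 2 * k)]: up to a factor 4, the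
    discriminant of the quadratic polynomial in [v^2] of the Duffing equation at
    parameter [k]. *)
Definition discr (E M k : R) : R := E^2 - 4 * E * k + M^2.

Definition orbit_time (E M k : R) : R :=
  ell (E - 2 * k) (sqrt (discr E M k)).

(** The derivative of [orbit_time] in [k], computed under the integral. *)
Definition orbit_time_slope (E M k : R) : R :=
  let w := E - 2 * k in let d := sqrt (discr E M k) in
  2 * ell_cos w d + 2 * E * (ell_sin w d / d).

Lemma locally_admissible (E M k : R) : 0 < E -> 2 * k < E -> 0 < discr E M k ->
  locally k (fun u => 2 * u < E /\ 0 < discr E M u).
Proof.
intros HE Hk Hd.
apply (filter_imp (fun u => u < E / 2 /\ u < (E^2 + M^2) / (4 * E))).
- intros u [H1 H2]; split; [lra |].
  apply (Rmult_lt_compat_l (4 * E)) in H2; [| lra].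
  unfold discr; replace (4 * E * ((E^2 + M^2) / (4 * E))) with (E^2 + M^2)
    in H2 by (field; lra).
  lra.
- apply filter_and; apply open_lt; [lra |].
  apply (Rmult_lt_reg_l (4 * E)); [lra |].
  replace (4 * E * ((E^2 + M^2) / (4 * E))) with (E^2 + M^2)
    by (field; lra).
  unfold discr in Hd; lra.
Qed.

Lemma is_derive_orbit_integrand (E M k x : R) :
  2 * k < E -> 0 < discr E M k ->
  let q := quad (E - 2 * k) (sqrt (discr E M k)) x in
  is_derive (fun u => 2 / sqrt (quad (E - 2 * u) (sqrt (discr E M u)) x)) k
    (2 * ((cos x)^2 / (q * sqrt q))
     + 2 * E / sqrt (discr E M k) * ((1 + (sin x)^2) / (q * sqrt q))).
Proof.
intros Hk Hd q.
assert (Hs := sqrt_lt_R0 _ Hd).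
assert (Hq : 0 < q) by (apply quad_pos; lra).
assert (Hr := sqrt_lt_R0 _ Hq).
assert (D : is_derive (fun u => quad (E - 2 * u) (sqrt (discr E M u)) x) k
  (- 2 * (cos x)^2 - 2 * E / sqrt (discr E M k) * (1 + (sin x)^2))).
{ unfold quad, discr in *; auto_derive; [lra |].
  replace (E * (E * 1) + - (4 * E * k) + M * (M * 1))
    with (E^2 - 4 * E * k + M^2) by ring.
  field; lra. }
apply (is_derive_ext (fun u => 2 *
  / sqrt (quad (E - 2 * u) (sqrt (discr E M u)) x))); [reflexivity |].
evar_last.
- apply is_derive_scal, (is_derive_inv (fun u => sqrt (quad _ _ x))).
  + apply is_derive_sqrt; [exact D | exact Hq].
  + apply Rgt_not_eq; exact Hr.
- unfold scal; simpl; unfold mult; simpl. fold q.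
  assert (Hrr := sqrt_sqrt q (Rlt_le _ _ Hq)).
  set (r := sqrt q) in *; rewrite <- Hrr; unfold one; simpl; field; lra.
Qed.

Lemma is_derive_orbit_time (E M k : R) :
  0 < E -> 2 * k < E -> 0 < discr E M k ->
  is_derive (orbit_time E M) k (orbit_time_slope E M k).
Proof.
intros HE Hk Hd.
assert (Hs := sqrt_lt_R0 _ Hd).
assert (L := locally_admissible E M k HE Hk Hd).
evar_last.
- apply (is_derive_RInt_param
    (fun u x => 2 / sqrt (quad (E - 2 * u) (sqrt (discr E M u)) x))).
  + revert L; apply filter_imp; intros u [H1 H2] x _.
    eexists; apply is_derive_orbit_integrand; assumption.
  + intros x _.
    apply (continuity_2d_pt_ext_loc (fun u x =>
      let q := quad (E - 2 * u) (sqrt (discr E M u)) x in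
      2 * ((cos x)^2 / (q * sqrt q))
      + 2 * E / sqrt (discr E M u) * ((1 + (sin x)^2) / (q * sqrt q)))).
    * destruct L as [e He]; exists e; intros u v Hu _; symmetry.
      apply is_derive_unique, is_derive_orbit_integrand; apply He, Hu.
    * assert (Hq : 0 < quad (E - 2 * k) (sqrt (discr E M k)) x)
        by (apply quad_pos; lra).
      assert (Hr := sqrt_lt_R0 _ Hq).
      unfold discr, quad, Rdiv in *; simpl in *.
      repeat first
        [ apply continuity_2d_pt_minus | apply continuity_2d_pt_plus
        | apply continuity_2d_pt_mult | apply continuity_2d_pt_const
        | apply continuity_2d_pt_id1 | apply continuity_2d_pt_id2
        | apply continuity_2d_pt_inv; [| try nra]
        | apply (continuity_1d_2d_pt_comp sqrt);
          [apply continuity_pt_sqrt; nra |]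
        | apply (continuity_1d_2d_pt_comp cos); [apply continuity_cos |]
        | apply (continuity_1d_2d_pt_comp sin); [apply continuity_sin |] ].
  + revert L; apply filter_imp; intros u [H1 H2].
    apply ex_RInt_quad_inv; [lra | apply sqrt_lt_R0, H2].
- rewrite (RInt_ext _ (fun x =>
      let q := quad (E - 2 * k) (sqrt (discr E M k)) x in
      2 * ((cos x)^2 / (q * sqrt q))
      + 2 * E / sqrt (discr E M k) * ((1 + (sin x)^2) / (q * sqrt q)))).
  + cbv zeta; rewrite RInt_lin.
    * unfold orbit_time_slope, ell_cos, ell_sin; field; lra.
    * apply ex_RInt_quad_cos2; lra.
    * apply ex_RInt_quad_sin2; lra.
  + intros x _; apply is_derive_unique, is_derive_orbit_integrand; assumption.
Qed.

Lemma orbit_time_pos (E M k : R) :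
  2 * k < E -> 0 < discr E M k -> 0 < orbit_time E M k.
Proof. intros Hk Hd; apply ell_pos; [lra | apply sqrt_lt_R0, Hd]. Qed.

(** The logarithmic derivative of [orbit_time E M k] in [k] is larger for
    smaller [M]: both of its terms are antitone in [sqrt (discr E M k)]. *)
Lemma orbit_time_log_slope (E M M' k : R) :
  0 < E -> M'^2 <= M^2 -> 2 * k < E -> 0 < discr E M' k ->
  orbit_time_slope E M k * orbit_time E M' k
  <= orbit_time_slope E M' k * orbit_time E M k.
Proof.
intros HE HM Hk Hd.
assert (Hs := sqrt_lt_R0 _ Hd).
assert (Hss : sqrt (discr E M' k) <= sqrt (discr E M k))
  by (apply sqrt_le_1_alt; unfold discr; lra).
assert (C := ell_cos_antitone (E - 2 * k) _ _ ltac:(lra) Hs Hss).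
assert (S := ell_sin_antitone (E - 2 * k) _ _ ltac:(lra) Hs Hss).
apply (Rmult_le_compat_l E) in S; [| lra].
unfold orbit_time_slope, orbit_time; lra.
Qed.

Lemma orbit_time_ratio_monotone (E M M' k k' : R) :
  0 < E -> M'^2 <= M^2 -> k <= k' -> 2 * k' < E -> 0 < discr E M' k' ->
  orbit_time E M' k / orbit_time E M k
  <= orbit_time E M' k' / orbit_time E M k'.
Proof.
intros HE HM Hkk Hk Hd.
assert (A : forall u, u <= k' ->
  2 * u < E /\ 0 < discr E M' u /\ 0 < discr E M u).
{ intros u Hu; unfold discr in *; repeat split; nra. }
assert (D : forall u, u <= k' ->
  is_derive (fun v => orbit_time E M' v / orbit_time E M v) u
    ((orbit_time_slope E M' u * orbit_time E M u
      - orbit_time E M' u * orbit_time_slope E M u) / orbit_time E M u ^ 2)).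
{ intros u Hu; destruct (A u Hu) as [H1 [H2 H3]].
  apply is_derive_div.
  - apply is_derive_orbit_time; assumption.
  - apply is_derive_orbit_time; assumption.
  - apply Rgt_not_eq, orbit_time_pos; assumption. }
destruct (MVT_gen (fun v => orbit_time E M' v / orbit_time E M v) k k'
  (fun u => (orbit_time_slope E M' u * orbit_time E M u
      - orbit_time E M' u * orbit_time_slope E M u) / orbit_time E M u ^ 2))
  as [u [Hu Eq]].
- intros u Hu; rewrite Rmax_right in Hu by assumption; apply D; lra.
- intros u Hu; rewrite Rmax_right in Hu by assumption.
  apply continuity_pt_filterlim, (ex_derive_continuous
    (fun v => orbit_time E M' v / orbit_time E M v)).
  eexists; apply D; lra.
- rewrite Rmax_right in Hu by assumption.
  destruct (A u ltac:(lra)) as [H1 [H2 H3]].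
  assert (L := orbit_time_log_slope E M M' u HE HM H1 H2).
  assert (P := orbit_time_pos E M u H1 H3).
  assert (0 <= (orbit_time_slope E M' u * orbit_time E M u
      - orbit_time E M' u * orbit_time_slope E M u) / orbit_time E M u ^ 2).
  { apply Rdiv_le_0_compat; [lra | apply pow_lt, P]. }
  nra.
Qed.

(** * The Duffing oscillator *)

(** The lower bound on the slope makes [g] Lipschitz, so that the first order
    expansion of [F] at [g t] can be read as one of [g] at [t]. *)
Lemma is_derive_right_inverse (F g : R -> R) (l f t : R) :
  0 < l -> (forall x y, x <= y -> l * (y - x) <= F y - F x) ->
  (forall s, F (g s) = s) -> 0 < f -> is_derive F (g t) f ->
  is_derive g t (/ f).
Proof.
intros Hl HF Hg Hf D.
assert (Lip : forall s, l * Rabs (g s - g t) <= Rabs (s - t)).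
{ intros s; generalize (HF (g s) (g t)) (HF (g t) (g s)); rewrite !Hg.
  destruct (Rle_dec (g s) (g t)).
  - rewrite (Rabs_left1 (g s - g t)) by lra.
    generalize (Rle_abs (- (s - t))); rewrite Rabs_Ropp; intros; lra.
  - rewrite (Rabs_right (g s - g t)) by lra.
    generalize (Rle_abs (s - t)); intros; lra. }
split; [apply is_linear_scal_l |].
intros x Hx.
rewrite <- (is_filter_lim_locally_unique (V := R_NormedModule) t x Hx).
intros eps.
assert (Heps : 0 < eps * (f * l))
  by (generalize (cond_pos eps); intros; repeat apply Rmult_lt_0_compat; lra).
destruct D as [_ D].
destruct (D (g t) (fun P H => H) (mkposreal _ Heps)) as [e He].
assert (Hle : 0 < l * e) by (generalize (cond_pos e); nra).
exists (mkposreal _ Hle); intros s Hs.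
assert (Hs' : Rabs (g s - g t) < e).
{ apply (Rmult_lt_reg_l l); [exact Hl |].
  eapply Rle_lt_trans; [apply Lip | exact Hs]. }
specialize (He _ Hs'); rewrite !Hg in He.
revert He; unfold norm, minus, plus, opp, scal; simpl;
  unfold abs, mult; simpl; intros He.
replace (g s + - g t + - ((s + - t) * / f))
  with (- / f * (s + - t + - ((g s + - g t) * f))) by (field; lra).
rewrite Rabs_mult, Rabs_Ropp, Rabs_inv, (Rabs_right f) by lra.
apply (Rmult_le_reg_l f); [exact Hf |].
rewrite <- Rmult_assoc, Rinv_r, Rmult_1_l by lra.
eapply Rle_trans; [exact He |].
generalize (Lip s) (cond_pos eps); unfold Rminus; intros Ls Pe.
replace (eps * (f * l) * Rabs (g s + - g t))
  with (eps * f * (l * Rabs (g s + - g t))) by ring.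
replace (f * (eps * Rabs (s + - t))) with (eps * f * Rabs (s + - t)) by ring.
apply Rmult_le_compat_l; [nra | exact Ls].
Qed.

Lemma quad_shift_PI (w d x : R) : quad w d (x + PI) = quad w d x.
Proof. unfold quad; rewrite neg_cos, neg_sin; ring. Qed.

(** The clock is the inverse of the elliptic integral
    [x |-> RInt (fun y => 2 / sqrt (quad w d y)) 0 x]. *)
Lemma clock (w d : R) : 0 < w -> 0 < d ->
  exists th : R -> R,
    th 0 = 0 /\
    (forall t, is_derive th t (sqrt (quad w d (th t)) / 2)) /\
    (forall s t, s < t -> th s < th t) /\
    (forall t, th (t + ell w d / 2) = th t + PI).
Proof.
intros Hw Hd.
set (f x := 2 / sqrt (quad w d x)).
set (F x := RInt f 0 x).
assert (Ef : forall a b, ex_RInt f a b)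
  by (intros; apply ex_RInt_quad_inv; assumption).
assert (Cf : forall x, continuous f x).
{ intros x; apply (ex_derive_continuous f); unfold f; derive_quad. }
assert (DF : forall x, is_derive F x (f x)).
{ intros x; apply (is_derive_RInt f F 0); [| apply Cf].
  apply filter_forall; intros y.
  apply (RInt_correct (V := R_CompleteNormedModule)), Ef. }
assert (Fdiff : forall x y, F y - F x = RInt f x y).
{ intros x y; unfold F.
  rewrite <- (RInt_Chasles f 0 x y) by apply Ef.
  unfold plus; simpl; ring. }
set (l := 2 / sqrt (w + 2 * d)).
assert (Hl : 0 < l).
{ apply Rdiv_lt_0_compat; [lra | apply sqrt_lt_R0; lra]. }
assert (Slope : forall x y, x <= y -> l * (y - x) <= F y - F x).
{ intros x y Hxy; rewrite Fdiff.
  replace (l * (y - x)) with (RInt (fun _ => l) x y)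
    by (rewrite RInt_const; unfold scal; simpl; unfold mult; simpl; ring).
  apply RInt_le; [exact Hxy | apply ex_RInt_const | apply Ef |].
  intros z _; unfold l, f; apply Rmult_le_compat_l; [lra |].
  apply Rinv_le_contravar.
  - apply sqrt_lt_R0, quad_pos; assumption.
  - apply sqrt_le_1_alt, quad_le; assumption. }
assert (F0 : F 0 = 0) by (unfold F; rewrite RInt_point; reflexivity).
assert (Fshift : forall x, F (x + PI) = F x + F PI).
{ intros x; replace (F (x + PI)) with (F PI + RInt f PI (x + PI))
    by (rewrite <- Fdiff; ring).
  rewrite Rplus_comm; f_equal; symmetry.
  replace PI with (1 * 0 + PI) at 1 by ring.
  replace (x + PI) with (1 * x + PI) by ring.
  rewrite <- RInt_comp_lin by apply Ef.
  apply RInt_ext; intros y _; unfold f, scal; simpl; unfold mult; simpl.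
  rewrite !Rmult_1_l, quad_shift_PI; reflexivity. }
assert (FT : F PI = ell w d / 2).
{ assert (H : F (PI + PI) = ell w d)
    by (unfold F, ell; f_equal; ring).
  rewrite Fshift in H; lra. }
assert (Inc : forall x y, F x <= F y -> x <= y).
{ intros x y H; destruct (Rle_dec x y) as [| N]; [assumption |].
  assert (S := Slope y x ltac:(lra)); nra. }
assert (Inv : forall t, {x | F x = t}).
{ intros t.
  assert (Ht : 0 <= Rabs t / l)
    by (apply Rdiv_le_0_compat; [apply Rabs_pos | exact Hl]).
  assert (El : l * (Rabs t / l) = Rabs t) by (field; lra).
  assert (S1 := Slope 0 _ Ht).
  assert (S2 := Slope (- (Rabs t / l)) 0 ltac:(lra)).
  rewrite F0, Rminus_0_r, El in S1.
  replace (l * (0 - - (Rabs t / l))) with (Rabs t) in S2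
    by (rewrite <- El at 1; ring).
  rewrite F0 in S2.
  destruct (IVT_gen F (- (Rabs t / l)) (Rabs t / l) t) as [x [_ Hx]].
  - intros x; apply continuity_pt_filterlim, (ex_derive_continuous F).
    eexists; apply DF.
  - generalize (Rle_abs t) (Rle_abs (- t)); rewrite Rabs_Ropp; intros.
    rewrite Rmin_left, Rmax_right by lra; lra.
  - exists x; exact Hx. }
exists (fun t => proj1_sig (Inv t)).
assert (FI : forall t, F (proj1_sig (Inv t)) = t)
  by (intros t; destruct (Inv t); assumption).
assert (Inj : forall x y, F x = F y -> x = y)
  by (intros x y H; apply Rle_antisym; apply Inc; lra).
refine (conj _ (conj _ (conj _ _))).
- apply Inj; rewrite FI, F0; reflexivity.
- intros t; set (x := proj1_sig (Inv t)).
  assert (Hx := sqrt_lt_R0 _ (quad_pos w d x Hw Hd)).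
  replace (sqrt (quad w d x) / 2) with (/ f x) by (unfold f; field; lra).
  apply (is_derive_right_inverse F (fun t => proj1_sig (Inv t)) l (f x) t);
    try assumption; [| apply DF].
  apply Rdiv_lt_0_compat; lra.
- intros s t Hst; apply Rnot_le_lt; intros N.
  assert (S := Slope _ _ N); rewrite !FI in S; nra.
- intros t; apply Inj; rewrite Fshift, !FI, FT; reflexivity.
Qed.

(** With [v = a * sin th] the equation becomes the one of the clock [th], and
    [quad B D] is symmetric in [A] and [C]: it only depends on them through
    [D].  This symmetry makes the periods of both factors of the Euler problem
    values of one function. *)
Lemma duffing (A B C D : R) : 0 < A -> 0 < B -> 0 < D -> D^2 = B^2 + A * C ->
  exists v u : R -> R,
    (forall t, is_derive v t (u t)) /\
    (forall t, is_derive u t (- (B * v t + C * (v t)^3) / 2)) /\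
    v 0 = 0 /\
    (forall t, 4 * (u t)^2 = A - 2 * B * (v t)^2 - C * (v t)^4) /\
    (forall t, (v t)^2 <= A / (B + D)) /\
    (forall t, v (t + ell B D / 2) = - v t /\ u (t + ell B D / 2) = - u t) /\
    (forall s t, v s = 0 -> 0 < t -> v (s + t) = 0 -> u (s + t) = u s ->
       ell B D <= t).
Proof.
intros HA HB HD HDD.
destruct (clock B D HB HD) as [th [th0 [Dth [Ith Sth]]]].
set (a := sqrt (A / (B + D))).
assert (Ha2 : 0 < A / (B + D)) by (apply Rdiv_lt_0_compat; lra).
assert (Ha : 0 < a) by (apply sqrt_lt_R0; exact Ha2).
assert (Haa : a * a = A / (B + D)) by (apply sqrt_sqrt; lra).
assert (Hq := fun t => quad_pos B D (th t) HB HD).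
assert (Hr := fun t => sqrt_lt_R0 _ (Hq t)).
assert (Hrr := fun t => sqrt_sqrt _ (Rlt_le _ _ (Hq t))).
assert (EA : A = a * a * (B + D)) by (rewrite Haa; field; lra).
assert (EC : C * (a * a) = D - B).
{ apply (Rmult_eq_reg_r (B + D)); [| lra].
  replace (C * (a * a) * (B + D)) with (C * A) by (rewrite EA; ring).
  replace ((D - B) * (B + D)) with (D^2 - B^2) by ring.
  rewrite HDD; ring. }
exists (fun t => a * sin (th t)).
exists (fun t => a * cos (th t) * sqrt (quad B D (th t)) / 2).
refine (conj _ (conj _ (conj _ (conj _ (conj _ (conj _ _)))))).
- intros t; specialize (Dth t); auto_derive; [eexists; exact Dth |].
  replace (Derive (fun x => th x) t) with (sqrt (quad B D (th t)) / 2)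
    by (symmetry; apply is_derive_unique, Dth).
  field.
- intros t; specialize (Dth t); specialize (Hr t); specialize (Hrr t).
  assert (Dq := is_derive_quad B D (th t)).
  auto_derive.
  + split; [eexists; exact Dth |].
    repeat split; [eexists; exact Dq | eexists; exact Dth | apply Hq].
  + replace (Derive (fun x => th x) t) with (sqrt (quad B D (th t)) / 2)
      by (symmetry; apply is_derive_unique, Dth).
    replace (Derive (fun x => quad B D x) (th t))
      with (2 * (D - B) * sin (th t) * cos (th t))
      by (symmetry; apply is_derive_unique, Dq).
    replace (C * (a * sin (th t))^3)
      with (C * (a * a) * a * (sin (th t))^3) by ring.
    rewrite EC.
    set (r := sqrt (quad B D (th t))) in *.
    field_simplify; [| lra].
    replace (r ^ 2) with (quad B D (th t)) by (rewrite <- Hrr; ring).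
    unfold quad; rewrite cos_sq; field.
- rewrite th0, sin_0; ring.
- intros t; specialize (Hrr t).
  replace (4 * (a * cos (th t) * sqrt (quad B D (th t)) / 2)^2)
    with (a * a * (cos (th t))^2
          * (sqrt (quad B D (th t)) * sqrt (quad B D (th t)))) by field.
  rewrite Hrr, quad_at, cos_sq.
  replace (C * (a * sin (th t))^4)
    with (C * (a * a) * (a * a) * (sin (th t))^4) by ring.
  rewrite EC, EA; ring.
- intros t; rewrite <- Haa; generalize (sin_sq_bound (th t)); nra.
- intros t; rewrite Sth, neg_sin, neg_cos, quad_shift_PI; split; field.
- intros s t Hs Ht Hst Hu.
  apply Rnot_lt_le; intros Hlt.
  assert (S2 : th (s + ell B D) = th s + 2 * PI).
  { replace (s + ell B D) with (s + ell B D / 2 + ell B D / 2) by field.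
    rewrite !Sth; ring. }
  assert (L1 := Ith s (s + t) ltac:(lra)).
  assert (L2 := Ith (s + t) (s + ell B D) ltac:(lra)).
  (* [v] vanishes at both times and [u] has the same sign: the clock has made an
     integral number of full turns. *)
  assert (Z1 : sin (th s) = 0) by nra.
  assert (Z2 : sin (th (s + t)) = 0) by nra.
  assert (Z3 : cos (th (s + t)) = cos (th s)).
  { assert (Eq : quad B D (th (s + t)) = quad B D (th s))
      by (rewrite !quad_at, Z1, Z2; reflexivity).
    rewrite Eq in Hu; specialize (Hr s).
    apply (Rmult_eq_reg_r (a * sqrt (quad B D (th s)))); nra. }
  set (x := th (s + t) - th s).
  assert (Cx : cos x = 1).
  { unfold x; rewrite cos_minus, Z1, Z3.
    generalize (cos_sq (th s)); rewrite Z1; lra. }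
  replace x with (2 * (x / 2)) in Cx by field.
  rewrite cos_2a_sin in Cx.
  assert (P : 0 < sin (x / 2)) by (apply sin_gt_0; unfold x; lra).
  nra.
Qed.

(** * Periods of one-dimensional Newton equations *)

Lemma continuous_bounded (h : R -> R) (a b : R) :
  (forall x, continuous h x) -> exists m, forall x, a <= x <= b -> Rabs (h x) <= m.
Proof.
intros Hh; destruct (Rle_dec a b) as [Hab | Hab].
- destruct (continuity_ab_maj (fun x => Rabs (h x)) a b Hab) as [x [Hx _]].
  + intros x _; apply continuity_pt_filterlim.
    apply (continuous_comp h Rabs); [apply Hh | apply continuous_Rabs].
  + exists (Rabs (h x)); exact Hx.
- exists 0; intros x Hx; lra.
Qed.

(** Gronwall's argument for [(q1 - q2)^2 + (p1 - p2)^2], on a time interval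
    [0, T] where both positions stay in a segment on which [f] is Lipschitz. *)
Lemma newton_unique (f f' q1 p1 q2 p2 : R -> R) :
  (forall x, is_derive f x (f' x)) -> (forall x, continuous f' x) ->
  (forall t, is_derive q1 t (p1 t)) -> (forall t, is_derive p1 t (- f (q1 t))) ->
  (forall t, is_derive q2 t (p2 t)) -> (forall t, is_derive p2 t (- f (q2 t))) ->
  q1 0 = q2 0 -> p1 0 = p2 0 ->
  forall T, 0 <= T -> q1 T = q2 T /\ p1 T = p2 T.
Proof.
intros Df Cf' Dq1 Dp1 Dq2 Dp2 Hq Hp T HT.
assert (Cq1 : forall x, continuous q1 x)
  by (intros x; apply (ex_derive_continuous q1); eexists; apply Dq1).
assert (Cq2 : forall x, continuous q2 x)
  by (intros x; apply (ex_derive_continuous q2); eexists; apply Dq2).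
destruct (continuous_bounded q1 0 T Cq1) as [m1 Hm1].
destruct (continuous_bounded q2 0 T Cq2) as [m2 Hm2].
set (m := Rmax m1 m2).
destruct (continuous_bounded f' (- m) m Cf') as [L HL].
assert (Bd : forall t, 0 <= t <= T -> - m <= q1 t <= m /\ - m <= q2 t <= m).
{ intros t Ht.
  assert (A1 := Rabs_le_between (q1 t) m); assert (A2 := Rabs_le_between (q2 t) m).
  split; [apply A1, (Rle_trans _ m1) | apply A2, (Rle_trans _ m2)]; auto.
  - apply Rmax_l.
  - apply Rmax_r. }
assert (Lip : forall t, 0 <= t <= T ->
  Rabs (f (q1 t) - f (q2 t)) <= L * Rabs (q1 t - q2 t)).
{ intros t Ht; destruct (Bd t Ht) as [B1 B2].
  destruct (MVT_gen f (q2 t) (q1 t) f') as [c [Hc Eq]].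
  - intros x _; apply Df.
  - intros x _; apply continuity_pt_filterlim, (ex_derive_continuous f).
    eexists; apply Df.
  - rewrite Eq, Rabs_mult; apply Rmult_le_compat_r; [apply Rabs_pos |].
    apply HL; revert Hc; apply Rmin_case; apply Rmax_case; lra. }
set (D t := ((q1 t - q2 t)^2 + (p1 t - p2 t)^2) * exp (- (1 + L) * t)).
set (D' t := (2 * (q1 t - q2 t) * (p1 t - p2 t)
              - 2 * (p1 t - p2 t) * (f (q1 t) - f (q2 t))
              - (1 + L) * ((q1 t - q2 t)^2 + (p1 t - p2 t)^2))
             * exp (- (1 + L) * t)).
assert (DD : forall t, is_derive D t (D' t)).
{ intros t; specialize (Dq1 t); specialize (Dq2 t);
  specialize (Dp1 t); specialize (Dp2 t).
  unfold D; auto_derive.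
  - repeat split; eexists; eassumption.
  - replace (Derive (fun x => q1 x) t) with (p1 t)
      by (symmetry; apply is_derive_unique, Dq1).
    replace (Derive (fun x => q2 x) t) with (p2 t)
      by (symmetry; apply is_derive_unique, Dq2).
    replace (Derive (fun x => p1 x) t) with (- f (q1 t))
      by (symmetry; apply is_derive_unique, Dp1).
    replace (Derive (fun x => p2 x) t) with (- f (q2 t))
      by (symmetry; apply is_derive_unique, Dp2).
    unfold D'; ring. }
destruct (MVT_gen D 0 T D') as [c [Hc Eq]].
- intros x _; apply DD.
- intros x _; apply continuity_pt_filterlim, (ex_derive_continuous D).
  eexists; apply DD.
- rewrite Rmin_left, Rmax_right in Hc by assumption.
  assert (D0 : D 0 = 0) by (unfold D; rewrite Hq, Hp; ring).
  assert (D'c : D' c <= 0).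
  { specialize (Lip c Hc); unfold D'.
    set (x := q1 c - q2 c) in *; set (y := p1 c - p2 c).
    set (z := f (q1 c) - f (q2 c)) in *.
    assert (X : - (2 * y * z) <= 2 * L * (Rabs x * Rabs y)).
    { apply (Rle_trans _ (2 * (Rabs y * Rabs z))).
      - rewrite <- Rabs_mult.
        generalize (Rle_abs (- (y * z))); rewrite Rabs_Ropp; lra.
      - assert (H := Rmult_le_compat_l _ _ _ (Rabs_pos y) Lip); lra. }
    assert (L0 : 0 <= L).
    { eapply Rle_trans; [apply Rabs_pos | apply (HL (q1 c))].
      apply Bd; exact Hc. }
    assert (XX : Rabs x * Rabs x = x^2)
      by (rewrite <- Rabs_mult, Rabs_right; [ring | nra]).
    assert (YY : Rabs y * Rabs y = y^2)
      by (rewrite <- Rabs_mult, Rabs_right; [ring | nra]).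
    assert (XY : 2 * (Rabs x * Rabs y) <= x^2 + y^2)
      by (rewrite <- XX, <- YY; generalize (pow2_ge_0 (Rabs x - Rabs y)); lra).
    assert (2 * x * y <= x^2 + y^2) by (generalize (pow2_ge_0 (x - y)); lra).
    assert (W := exp_pos (- (1 + L) * c)).
    assert (2 * x * y - 2 * y * z - (1 + L) * (x^2 + y^2) <= 0) by nra.
    nra. }
  assert (DT : D T <= 0) by nra.
  assert (W := exp_pos (- (1 + L) * T)); unfold D in DT.
  assert (S : (q1 T - q2 T)^2 + (p1 T - p2 T)^2 <= 0) by nra.
  generalize (pow2_ge_0 (q1 T - q2 T)) (pow2_ge_0 (p1 T - p2 T)); intros.
  split; nra.
Qed.

Lemma is_derive_shift (g : R -> R) (s t l : R) :
  is_derive g (s + t) l -> is_derive (fun x => g (s + x)) t l.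
Proof.
intros D; auto_derive; [eexists; exact D |].
rewrite Rmult_1_l; apply is_derive_unique, D.
Qed.

(** A trajectory of energy [b] from the fibre over [x0] starts at one of the
    two momenta [P 0] and [- P 0], hence is a time translate of [(Q, P)] by [0]
    or by half a period. *)
Lemma period_newton (eqQ : R -> R -> Prop) (H : R -> R -> R)
  (W f f' : R -> R) (x0 b T : R) (Q P : R -> R) :
  (forall x p, H x p = 1/2 * p^2 + W x) ->
  (forall x, is_derive W x (f x)) ->
  (forall x, is_derive f x (f' x)) -> (forall x, continuous f' x) ->
  (forall t, is_derive Q t (P t)) -> (forall t, is_derive P t (- f (Q t))) ->
  Q 0 = x0 -> 1/2 * (P 0)^2 + W x0 = b -> 0 < T ->
  Q (T / 2) = x0 -> P (T / 2) = - P 0 ->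
  (forall t, eqQ (Q (t + T)) (Q t) /\ P (t + T) = P t) ->
  (forall s t, Q s = x0 -> 0 < t -> eqQ (Q (s + t)) x0 -> P (s + t) = P s ->
     T <= t) ->
  period eqQ H x0 b = T.
Proof.
intros HH DW Df Cf' DQ DP Q0 Hb HT QT PT Per Min.
assert (Hp : forall q p, Derive (fun y => H q y) p = p).
{ intros q p; rewrite (Derive_ext _ (fun y => 1/2 * y^2 + W q))
    by (intros; apply HH).
  apply is_derive_unique; auto_derive; [easy | field]. }
assert (Hq : forall q p, Derive (fun x => H x p) q = f q).
{ intros q p; rewrite (Derive_ext _ (fun x => 1/2 * p^2 + W x))
    by (intros; apply HH).
  apply is_derive_unique; auto_derive; [eexists; apply DW |].
  rewrite Rmult_1_l; apply is_derive_unique, DW. }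
unfold period; rewrite (is_glb_Rbar_unique _ (Finite T)); [reflexivity |].
split.
- intros T' [HT' [q [p [Tr [q0 [Hqp Per']]]]]]; simpl.
  assert (Dq : forall t, is_derive q t (p t))
    by (intros t; destruct (Tr t) as [A _]; rewrite Hp in A; exact A).
  assert (Dp : forall t, is_derive p t (- f (q t)))
    by (intros t; destruct (Tr t) as [_ A]; rewrite Hq in A; exact A).
  assert (Start : exists s, Q s = x0 /\ P s = p 0).
  { rewrite HH, q0 in Hqp.
    assert (E : (p 0 - P 0) * (p 0 + P 0) = 0) by nra.
    destruct (Rmult_integral _ _ E).
    - exists 0; split; [exact Q0 | lra].
    - exists (T / 2); split; [exact QT | lra]. }
  destruct Start as [s [Qs Ps]].
  destruct (newton_unique f f' q p (fun t => Q (s + t)) (fun t => P (s + t))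
    Df Cf' Dq Dp) with (T := T') as [E1 E2].
  + intros t; apply is_derive_shift, DQ.
  + intros t; apply is_derive_shift, DP.
  + rewrite Rplus_0_r; congruence.
  + rewrite Rplus_0_r; congruence.
  + lra.
  + destruct (Per' 0) as [P1 P2]; rewrite Rplus_0_l in P1, P2.
    apply (Min s); try assumption; [| congruence].
    rewrite <- E1, <- q0; exact P1.
- intros l Hl; apply Hl; split; [exact HT |].
  exists Q, P; refine (conj _ (conj Q0 (conj _ Per))).
  + intros t; rewrite Hp, Hq; split; [apply DQ | apply DP].
  + rewrite HH, Q0; exact Hb.
Qed.

(** * The two periods of the Euler problem *)


Lemma cosh_two_artanh (v : R) : -1 < v < 1 ->
  cosh (ln ((1 + v) / (1 - v))) = (1 + v^2) / (1 - v^2).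
Proof.
intros Hv; assert (P : 0 < (1 + v) / (1 - v)) by (apply Rdiv_lt_0_compat; lra).
unfold cosh; rewrite <- ln_Rinv, !exp_ln by (try apply Rinv_0_lt_compat; auto).
field; split; [nra | lra].
Qed.

Lemma sinh_two_artanh (v : R) : -1 < v < 1 ->
  sinh (ln ((1 + v) / (1 - v))) = 2 * v / (1 - v^2).
Proof.
intros Hv; assert (P : 0 < (1 + v) / (1 - v)) by (apply Rdiv_lt_0_compat; lra).
unfold sinh; rewrite <- ln_Rinv, !exp_ln by (try apply Rinv_0_lt_compat; auto).
field; split; [nra | lra].
Qed.

Lemma two_artanh_eq_0 (v : R) : -1 < v < 1 ->
  ln ((1 + v) / (1 - v)) = 0 -> v = 0.
Proof.
intros Hv H; assert (P : 0 < (1 + v) / (1 - v)) by (apply Rdiv_lt_0_compat; lra).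
rewrite <- ln_1 in H; apply ln_inv in H; [| exact P | lra].
apply (Rmult_eq_compat_r (1 - v)) in H; field_simplify in H; lra.
Qed.

Lemma cos_two_atan (v : R) : cos (2 * atan v) = (1 - v^2) / (1 + v^2).
Proof.
assert (P : 0 < 1 + v^2) by nra.
assert (S := sqrt_lt_R0 _ P); assert (SS := sqrt_sqrt _ (Rlt_le _ _ P)).
rewrite cos_2a_sin, sin_atan; unfold Rsqr; replace (v * v) with (v^2) by ring.
replace (2 * (v / sqrt (1 + v^2)) * (v / sqrt (1 + v^2)))
  with (2 * v^2 / (sqrt (1 + v^2) * sqrt (1 + v^2))) by (field; lra).
rewrite SS; field; lra.
Qed.

Lemma sin_two_atan (v : R) : sin (2 * atan v) = 2 * v / (1 + v^2).
Proof.
assert (P : 0 < 1 + v^2) by nra.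
assert (S := sqrt_lt_R0 _ P); assert (SS := sqrt_sqrt _ (Rlt_le _ _ P)).
rewrite sin_2a, sin_atan, cos_atan; unfold Rsqr;
  replace (v * v) with (v^2) by ring.
replace (2 * (v / sqrt (1 + v^2)) * (1 / sqrt (1 + v^2)))
  with (2 * v / (sqrt (1 + v^2) * sqrt (1 + v^2))) by (field; lra).
rewrite SS; reflexivity.
Qed.

(** In the coordinate [v = tanh (mu / 2)], the equations of [K1] at energy [- k]
    become the Duffing equation. *)
Lemma tau1_orbit_time (m1 m2 c k : R) :
  0 <= M1 m1 m2 -> M1 m1 m2 < - c -> 2 * k < M1 m1 m2 ->
  tau1 m1 m2 c (- k) = orbit_time (- c) (M1 m1 m2) k.
Proof.
unfold tau1, K1; set (M := M1 m1 m2); intros HM HMc Hk.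
assert (Hd : 0 < discr (- c) M k) by (unfold discr; nra).
set (D := sqrt (discr (- c) M k)).
assert (HD : 0 < D) by (apply sqrt_lt_R0; exact Hd).
assert (HDD : D * D = discr (- c) M k) by (apply sqrt_sqrt; lra).
destruct (duffing (M - 2 * k) (- c - 2 * k) (M + 2 * k) D)
  as [v [u [Dv [Du [v0 [En [Bv [Half Min]]]]]]]]; try lra.
{ replace (D^2) with (D * D) by ring; rewrite HDD; unfold discr; ring. }
assert (Hv : forall t, -1 < v t < 1).
{ intros t; specialize (Bv t).
  assert ((M - 2 * k) / (- c - 2 * k + D) < 1).
  { apply (Rmult_lt_reg_r (- c - 2 * k + D)); [lra |].
    field_simplify; lra. }
  split; nra. }
assert (Hw : forall t, 0 < 1 - (v t)^2) by (intros t; specialize (Hv t); nra).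
set (T := ell (- c - 2 * k) D) in *.
assert (HT : 0 < T) by (apply ell_pos; lra).
apply (period_newton eq _
  (fun x => - c / 4 * ((cosh x)^2 - 1) - M / 2 * cosh x)
  (fun x => - c / 2 * cosh x * sinh x - M / 2 * sinh x)
  (fun x => - c / 2 * ((cosh x)^2 + (sinh x)^2) - M / 2 * cosh x)
  0 (- k) T
  (fun t => ln ((1 + v t) / (1 - v t)))
  (fun t => 2 * u t / (1 - (v t)^2))).
- intros x p; field.
- intros x; auto_derive; [easy | field].
- intros x; auto_derive; [easy | field].
- intros x; apply (ex_derive_continuous
    (fun x => - c / 2 * ((cosh x)^2 + (sinh x)^2) - M / 2 * cosh x)).
  auto_derive; easy.
- intros t; specialize (Hv t); specialize (Dv t).
  auto_derive.
  + repeat split; try (eexists; exact Dv); [lra |].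
    apply Rdiv_lt_0_compat; lra.
  + replace (Derive (fun x => v x) t) with (u t)
      by (symmetry; apply is_derive_unique, Dv).
    specialize (Hw t); field; repeat split; lra || nra.
- intros t; specialize (Hw t); specialize (Hv t).
  rewrite cosh_two_artanh, sinh_two_artanh by exact Hv.
  specialize (Dv t); specialize (Du t); specialize (En t).
  auto_derive.
  + repeat split; try (eexists; eassumption); nra.
  + replace (Derive (fun x => v x) t) with (u t)
      by (symmetry; apply is_derive_unique, Dv).
    replace (Derive (fun x => u x) t)
      with (- ((- c - 2 * k) * v t + (M + 2 * k) * (v t)^3) / 2)
      by (symmetry; apply is_derive_unique, Du).
    field_simplify_eq; [| lra].
    replace (u t ^ 2) with ((4 * (u t)^2) / 4) by field.
    rewrite En; field.
- rewrite v0, Rplus_0_r, Rminus_0_r, Rdiv_1_r; apply ln_1.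
- specialize (En 0); rewrite v0 in *; rewrite cosh_0.
  replace (2 * u 0 / (1 - 0^2)) with (2 * u 0) by field.
  nra.
- exact HT.
- rewrite <- (Rplus_0_l (T / 2)); destruct (Half 0) as [-> _].
  rewrite v0, Ropp_0, Rplus_0_r, Rminus_0_r, Rdiv_1_r; apply ln_1.
- rewrite <- (Rplus_0_l (T / 2)); destruct (Half 0) as [-> ->].
  rewrite v0; field.
- intros t; replace (t + T) with (t + T / 2 + T / 2) by field.
  destruct (Half (t + T / 2)) as [-> ->]; destruct (Half t) as [-> ->].
  rewrite !Ropp_involutive; split; reflexivity.
- intros s t Hs Ht Hst Hp.
  apply two_artanh_eq_0 in Hs; [| apply Hv].
  apply two_artanh_eq_0 in Hst; [| apply Hv].
  rewrite Hs, Hst in Hp.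
  apply (Min s); try assumption; lra.
Qed.

(** Same as for [tau1], with [v = tan ((nu - PI) / 2)]. *)
Lemma tau2_orbit_time (m1 m2 c k : R) :
  2 * k < - c -> 0 < discr (- c) (M2 m1 m2) k -> 0 < M2 m1 m2 + 2 * k ->
  tau2 m1 m2 c k = orbit_time (- c) (M2 m1 m2) k.
Proof.
unfold tau2, K2; set (M := M2 m1 m2); intros Hk Hd HA.
set (D := sqrt (discr (- c) M k)).
assert (HD : 0 < D) by (apply sqrt_lt_R0; exact Hd).
assert (HDD : D * D = discr (- c) M k) by (apply sqrt_sqrt; lra).
destruct (duffing (M + 2 * k) (- c - 2 * k) (M - 2 * k) D)
  as [v [u [Dv [Du [v0 [En [_ [Half Min]]]]]]]]; try lra.
{ replace (D^2) with (D * D) by ring; rewrite HDD; unfold discr; ring. }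
assert (Hw : forall t, 0 < 1 + (v t)^2) by (intros t; nra).
set (T := ell (- c - 2 * k) D) in *.
assert (HT : 0 < T) by (apply ell_pos; lra).
apply (period_newton eq_circle _
  (fun x => c / 4 * ((cos x)^2 - 1) + M / 2 * cos x)
  (fun x => - c / 2 * cos x * sin x - M / 2 * sin x)
  (fun x => - c / 2 * ((cos x)^2 - (sin x)^2) - M / 2 * cos x)
  PI k T
  (fun t => 2 * atan (v t) + PI)
  (fun t => 2 * u t / (1 + (v t)^2))).
- intros x p; field.
- intros x; auto_derive; [easy | field].
- intros x; auto_derive; [easy | field].
- intros x; apply (ex_derive_continuous
    (fun x => - c / 2 * ((cos x)^2 - (sin x)^2) - M / 2 * cos x)).
  auto_derive; easy.
- intros t; specialize (Dv t); auto_derive; [eexists; exact Dv |].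
  replace (Derive (fun x => v x) t) with (u t)
    by (symmetry; apply is_derive_unique, Dv).
  specialize (Hw t); unfold Rsqr; field; nra.
- intros t; specialize (Hw t).
  rewrite neg_cos, neg_sin, cos_two_atan, sin_two_atan.
  specialize (Dv t); specialize (Du t); specialize (En t).
  auto_derive.
  + repeat split; try (eexists; eassumption); nra.
  + replace (Derive (fun x => v x) t) with (u t)
      by (symmetry; apply is_derive_unique, Dv).
    replace (Derive (fun x => u x) t)
      with (- ((- c - 2 * k) * v t + (M - 2 * k) * (v t)^3) / 2)
      by (symmetry; apply is_derive_unique, Du).
    field_simplify_eq; [| lra].
    replace (u t ^ 2) with ((4 * (u t)^2) / 4) by field.
    rewrite En; field.
- rewrite v0, atan_0; ring.
- specialize (En 0); rewrite v0 in *; rewrite cos_PI.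
  replace (2 * u 0 / (1 + 0^2)) with (2 * u 0) by field.
  nra.
- exact HT.
- rewrite <- (Rplus_0_l (T / 2)); destruct (Half 0) as [-> _].
  rewrite v0, Ropp_0, atan_0; ring.
- rewrite <- (Rplus_0_l (T / 2)); destruct (Half 0) as [-> ->].
  rewrite v0; field.
- intros t; replace (t + T) with (t + T / 2 + T / 2) by field.
  destruct (Half (t + T / 2)) as [-> ->]; destruct (Half t) as [-> ->].
  rewrite !Ropp_involutive; split; [| reflexivity].
  exists 0%Z; ring.
- intros s t Hs Ht [n Hst] Hp.
  assert (At : forall y, atan y = 0 -> y = 0)
    by (intros y Hy; rewrite <- (tan_atan y), Hy; apply tan_0).
  assert (Vs : v s = 0) by (apply At; lra).
  assert (Vst : v (s + t) = 0).
  { apply At.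
    (* [atan] takes values in an interval shorter than the circle. *)
    assert (n = 0%Z) as ->; [| lra].
    assert (E : atan (v (s + t)) = PI * IZR n) by lra.
    generalize (atan_bound (v (s + t))) PI_RGT_0; rewrite E; intros B P.
    assert (-1 < IZR n < 1) as [N1 N2] by (split; nra).
    apply lt_IZR in N1; apply lt_IZR in N2; lia. }
  rewrite Vs, Vst in Hp.
  apply (Min s); try assumption; lra.
Qed.

(** * Regions below a curve of monotone slope *)

(** Each point gets a radius whose ball either lies in a member of the cover or
    misses [A]; finitely many such balls cover the rectangle. *)
Lemma compact_of_closed_bounded (A : R * R -> Prop) (a b : R) :
  closed (T := prod_UniformSpace R_UniformSpace R_UniformSpace) A ->
  (forall z, A z -> - a <= fst z <= a /\ - b <= snd z <= b) ->
  compact_set (X := prod_UniformSpace R_UniformSpace R_UniformSpace) A.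
Proof.
intros HA Hb I U HU Hcov.
set (Pl := prod_UniformSpace R_UniformSpace R_UniformSpace).
assert (Radius : forall t : Compactness.Tn 2 R, {e : posreal |
  (A (fst t, fst (snd t)) -> exists i, forall z : Pl,
     ball (M := Pl) (fst t, fst (snd t)) e z -> U i z) /\
  (~ A (fst t, fst (snd t)) -> forall z : Pl,
     ball (M := Pl) (fst t, fst (snd t)) e z -> ~ A z)}).
{ intros t; apply constructive_indefinite_description.
  destruct (classic (A (fst t, fst (snd t)))) as [At | At].
  - destruct (Hcov _ At) as [i Hi]; destruct (HU i _ Hi) as [e He].
    exists e; split; [intros _; exists i; exact He | contradiction].
  - assert (L : locally (T := Pl) (fst t, fst (snd t)) (fun z => ~ A z)).
    { apply NNPP; intros N; apply At, HA, N. }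
    destruct L as [e He].
    exists e; split; [contradiction | intros _; exact He]. }
set (delta t := proj1_sig (Radius t)).
apply NNPP; intros N.
apply (compactness_list 2 (- a, (- b, tt)) (a, (b, tt)) delta).
intros [l Hl]; apply N.
assert (Sub : forall l' : list (Compactness.Tn 2 R), exists li : list I,
  forall t, In t l' -> A (fst t, fst (snd t)) ->
  exists i, In i li /\ forall z : Pl,
     ball (M := Pl) (fst t, fst (snd t)) (delta t) z -> U i z).
{ induction l' as [| t l' [li IH]]; [exists nil; intros t [] |].
  destruct (classic (A (fst t, fst (snd t)))) as [At | At].
  - destruct (proj1 (proj2_sig (Radius t)) At) as [i Hi].
    exists (i :: li); intros s [<- | Hs] As.
    + exists i; split; [left; reflexivity | exact Hi].
    + destruct (IH s Hs As) as [j [Hj Uj]].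
      exists j; split; [right; exact Hj | exact Uj].
  - exists li; intros s [<- | Hs] As; [contradiction | exact (IH s Hs As)]. }
destruct (Sub l) as [li Hli].
exists li; intros [x y] Axy.
destruct (Hb _ Axy) as [Bx By]; simpl in Bx, By.
destruct (Hl (x, (y, tt))) as [t [Ht [_ Ct]]]; [simpl; auto |].
assert (Bt : ball (M := Pl) (fst t, fst (snd t)) (delta t) (x, y)).
{ destruct t as [t1 [t2 []]]; destruct Ct as [C1 [C2 _]].
  split; [exact C1 | exact C2]. }
destruct (classic (A (fst t, fst (snd t)))) as [At | At].
- destruct (Hli t Ht At) as [i [Hi Ui]]; exists i; auto.
- exfalso; exact (proj2 (proj2_sig (Radius t)) At _ Bt Axy).
Qed.

Lemma closed_le_const {T : UniformSpace} (F : T -> R) (c : R) :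
  (forall z, continuous F z) -> closed (fun z => F z <= c).
Proof.
intros CF z Hz; apply Rnot_lt_le; intros Hlt; apply Hz.
apply (filter_imp (fun y => c < F y)); [intros y Hy; lra |].
apply (CF z (fun r => c < r)), open_gt, Hlt.
Qed.

(** The decreasing curve with velocity [(- g1 k, g2 k)], from the [rho2]-axis
    at [k = hi] to the [rho1]-axis at [k = lo]. *)
Definition under_curve (g1 g2 : R -> R) (lo hi : R) (rho : R * R) : Prop :=
  0 <= fst rho <= RInt g1 lo hi /\
  exists k, lo <= k <= hi /\ fst rho = RInt g1 k hi /\
    0 <= snd rho <= RInt g2 lo k.

Lemma ex_RInt_continuous_lt (g : R -> R) (h a b : R) :
  (forall k, k < h -> continuous g k) -> a < h -> b < h -> ex_RInt g a b.
Proof.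
intros Cg Ha Hb; apply (ex_RInt_continuous (V := R_CompleteNormedModule)).
intros k Hk; apply Cg; revert Hk; apply Rmax_case; lra.
Qed.

Lemma RInt_split (g : R -> R) (h a b d : R) :
  (forall k, k < h -> continuous g k) -> a < h -> b < h -> d < h ->
  RInt g a d = RInt g a b + RInt g b d.
Proof.
intros Cg Ha Hb Hd; symmetry.
apply (RInt_Chasles g a b d); apply ex_RInt_continuous_lt with h; assumption.
Qed.

Lemma RInt_self (g : R -> R) (a : R) : RInt g a a = 0.
Proof. exact (RInt_point a g). Qed.

Lemma RInt_pos (g : R -> R) (h a b : R) :
  (forall k, k < h -> continuous g k) -> b < h -> a < b ->
  (forall k, a < k < b -> 0 < g k) -> 0 < RInt g a b.
Proof.
intros Cg Hb Hab Pg; apply RInt_gt_0; [exact Hab | exact Pg |].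
intros k Hk; apply Cg; lra.
Qed.

Lemma under_curve_param (g1 : R -> R) (lo hi h : R) :
  lo < hi -> hi < h -> (forall k, k < h -> continuous g1 k) ->
  forall x, 0 <= x <= RInt g1 lo hi -> {k | lo <= k <= hi /\ RInt g1 k hi = x}.
Proof.
intros Hlo Hhi Cg x Hx.
destruct (Ranalysis5.f_interv_is_interv (fun k => - RInt g1 k hi) lo hi (- x))
  as [k [Hk Eq]].
- exact Hlo.
- rewrite RInt_self; lra.
- intros k Hk; apply continuity_pt_filterlim.
  apply (ex_derive_continuous (fun k => - RInt g1 k hi)).
  apply (ex_derive_opp (fun k => RInt g1 k hi)).
  exists (opp (g1 k)); apply (is_derive_RInt' g1 _ k hi); [| apply Cg; lra].
  apply (filter_imp (fun u => u < h)); [| apply open_lt; lra].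
  intros u Hu; apply (RInt_correct (V := R_CompleteNormedModule)).
  apply ex_RInt_continuous_lt with h; lra || assumption.
- exists k; split; [exact Hk | lra].
Qed.

(** If the slope [g2 / g1] is monotone along the curve, the curve lies on one
    side of each of its tangents ([s = 1] when it increases, [s = - 1] when it
    decreases). *)
Lemma tangent_side (g1 g2 : R -> R) (lo hi h s : R) :
  hi < h ->
  (forall k, k < h -> continuous g1 k) -> (forall k, k < h -> continuous g2 k) ->
  (forall k, lo <= k <= hi -> 0 < g1 k) ->
  (forall k k', lo <= k -> k <= k' -> k' <= hi ->
     s * (g2 k / g1 k) <= s * (g2 k' / g1 k')) ->
  forall k0 k, lo <= k0 <= hi -> lo <= k <= hi ->
  s * (RInt g2 lo k0 + g2 k0 / g1 k0 * RInt g1 k0 hi)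
  <= s * (RInt g2 lo k + g2 k0 / g1 k0 * RInt g1 k hi).
Proof.
intros Hhi C1 C2 P1 Mon k0 k Hk0 Hk.
set (r := g2 k0 / g1 k0).
assert (I1 : forall a b, a <= hi -> b <= hi -> ex_RInt g1 a b)
  by (intros; apply ex_RInt_continuous_lt with h; lra || assumption).
assert (I2 : forall a b, a <= hi -> b <= hi -> ex_RInt g2 a b)
  by (intros; apply ex_RInt_continuous_lt with h; lra || assumption).
assert (Val : forall j, lo <= j <= hi ->
  s * g2 j + - (s * r) * g1 j = g1 j * (s * (g2 j / g1 j) - s * r))
  by (intros j Hj; specialize (P1 j Hj); field; lra).
destruct (Rle_dec k0 k) as [L | L].
- assert (X : 0 <= RInt (fun j => s * g2 j + - (s * r) * g1 j) k0 k).
  { apply RInt_ge_0; [exact L | apply ex_RInt_lin; [apply I2 | apply I1]; lra |].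
    intros j Hj; rewrite Val by lra.
    apply Rmult_le_pos; [apply Rlt_le, P1; lra |].
    assert (M := Mon k0 j ltac:(lra) ltac:(lra) ltac:(lra)); unfold r; lra. }
  rewrite RInt_lin in X by ((apply I1 || apply I2); lra).
  rewrite (RInt_split g2 h lo k0 k), (RInt_split g1 h k0 k hi)
    by (assumption || lra).
  lra.
- assert (X : 0 <= RInt (fun j => (- s) * g2 j + (s * r) * g1 j) k k0).
  { apply RInt_ge_0; [lra | apply ex_RInt_lin; [apply I2 | apply I1]; lra |].
    intros j Hj.
    replace (- s * g2 j + s * r * g1 j)
      with (- (s * g2 j + - (s * r) * g1 j)) by ring.
    rewrite Val by lra.
    assert (M := Mon j k0 ltac:(lra) ltac:(lra) ltac:(lra)).
    fold r in M; specialize (P1 j ltac:(lra)); nra. }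
  rewrite RInt_lin in X by ((apply I1 || apply I2); lra).
  rewrite (RInt_split g2 h lo k k0), (RInt_split g1 h k k0 hi)
    by (assumption || lra).
  lra.
Qed.

Lemma under_curve_in_quadrant (g1 g2 : R -> R) (lo hi : R) :
  in_quadrant (under_curve g1 g2 lo hi).
Proof. intros rho [Hx [k [_ [_ Hy]]]]; split; lra. Qed.

Lemma under_curve_concave (g1 g2 : R -> R) (lo hi h : R) :
  lo < hi -> hi < h ->
  (forall k, k < h -> continuous g1 k) -> (forall k, k < h -> continuous g2 k) ->
  (forall k, lo <= k <= hi -> 0 < g1 k) -> (forall k, lo <= k <= hi -> 0 < g2 k) ->
  (forall k k', lo <= k -> k <= k' -> k' <= hi ->
     g2 k / g1 k <= g2 k' / g1 k') ->
  concave_toric_domain (toric_domain (under_curve g1 g2 lo hi)).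
Proof.
intros Hlo Hhi C1 C2 P1 P2 Mon.
exists (under_curve g1 g2 lo hi).
split; [apply under_curve_in_quadrant |]; split; [tauto |].
set (a := RInt g1 lo hi).
assert (Ha : 0 < a)
  by (apply (RInt_pos g1 h); try assumption; intros; apply P1; lra).
assert (Param : forall x, {k | lo <= k <= hi /\
                                (0 <= x <= a -> RInt g1 k hi = x)}).
{ intros x; destruct (Rle_dec 0 x) as [H0 | H0];
    [destruct (Rle_dec x a) as [H1 | H1] |].
  - destruct (under_curve_param g1 lo hi h Hlo Hhi C1 x) as [k [Hk Eq]].
    + split; assumption.
    + exists k; split; auto.
  - exists lo; split; [lra | intros; lra].
  - exists lo; split; [lra | intros; lra]. }
set (kap x := proj1_sig (Param x)).
assert (Hk : forall x, lo <= kap x <= hi)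
  by (intros x; exact (proj1 (proj2_sig (Param x)))).
assert (HX : forall x, 0 <= x <= a -> RInt g1 (kap x) hi = x)
  by (intros x; exact (proj2 (proj2_sig (Param x)))).
assert (Xdec : forall k k', lo <= k -> k < k' -> k' <= hi ->
  RInt g1 k' hi < RInt g1 k hi).
{ intros k k' H1 H2 H3; rewrite (RInt_split g1 h k k' hi) by (assumption || lra).
  assert (0 < RInt g1 k k')
    by (apply (RInt_pos g1 h); try assumption; intros; try apply P1; lra).
  lra. }
assert (Yinc : forall k k', lo <= k -> k < k' -> k' <= hi ->
  RInt g2 lo k < RInt g2 lo k').
{ intros k k' H1 H2 H3; rewrite (RInt_split g2 h lo k k') by (assumption || lra).
  assert (0 < RInt g2 k k')
    by (apply (RInt_pos g2 h); try assumption; intros; try apply P2; lra).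
  lra. }
assert (Inj : forall k x, lo <= k <= hi -> 0 <= x <= a -> x = RInt g1 k hi ->
  k = kap x).
{ intros k x K X Eq; specialize (HX x X); specialize (Hk x).
  destruct (Rtotal_order k (kap x)) as [L | [L | L]]; [| exact L |].
  - assert (D := Xdec k (kap x) ltac:(lra) L ltac:(lra)); lra.
  - assert (D := Xdec (kap x) k ltac:(lra) L ltac:(lra)); lra. }
(* The height of the curve above [x] is read at the parameter [kap x]. *)
exists a, (fun x => RInt g2 lo (kap x)).
split; [exact Ha |]; split; [| split; [| split; [| split]]].
- intros x Hx; destruct (Hk x) as [[L | <-] _].
  + assert (Y := Yinc lo (kap x) ltac:(lra) L ltac:(apply Hk)).
    rewrite RInt_self in Y; lra.
  + rewrite RInt_self; lra.
- rewrite <- (Inj lo a); [apply RInt_self | lra | lra | reflexivity].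
- intros x y t Hx Hy Ht.
  set (z := t * x + (1 - t) * y).
  assert (Hz : 0 <= z <= a) by (unfold z; split; nra).
  assert (Mon' : forall k k', lo <= k -> k <= k' -> k' <= hi ->
    1 * (g2 k / g1 k) <= 1 * (g2 k' / g1 k'))
    by (intros; rewrite !Rmult_1_l; apply Mon; assumption).
  assert (Tx := tangent_side g1 g2 lo hi h 1 Hhi C1 C2 P1 Mon' _ _ (Hk z) (Hk x)).
  assert (Ty := tangent_side g1 g2 lo hi h 1 Hhi C1 C2 P1 Mon' _ _ (Hk z) (Hk y)).
  rewrite !HX in Tx, Ty by assumption.
  revert Tx Ty; set (r := g2 (kap z) / g1 (kap z)); intros Tx Ty.
  apply (Rmult_le_compat_l t) in Tx; [| lra].
  apply (Rmult_le_compat_l (1 - t)) in Ty; [| lra].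
  assert (r * z = t * (r * x) + (1 - t) * (r * y)) by (unfold z; ring).
  lra.
- intros x y Hx Hxy Hy; apply Yinc; try apply Hk.
  apply Rnot_le_lt; intros [L | L].
  + assert (D := Xdec (kap x) (kap y) ltac:(apply Hk) L ltac:(apply Hk)).
    rewrite !HX in D; lra.
  + assert (E : x = y) by (rewrite <- (HX x), <- (HX y), L; lra); lra.
- intros x y; split.
  + intros [Hx [k [K [Eq Hy]]]]; simpl in *.
    rewrite <- (Inj k x) by assumption; split; assumption.
  + intros [Hx Hy]; split; [exact Hx |].
    exists (kap x); simpl; rewrite HX by assumption; auto.
Qed.

Lemma Rabs_convex (x y t : R) : 0 <= t <= 1 ->
  Rabs (t * x + (1 - t) * y) <= t * Rabs x + (1 - t) * Rabs y.
Proof.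
intros Ht; eapply Rle_trans; [apply Rabs_triang |].
rewrite !Rabs_mult, (Rabs_right t), (Rabs_right (1 - t)) by lra; lra.
Qed.

(** When the slope decreases, the region is cut out of a strip by the
    half-planes below the tangents, so its reflection is an intersection of
    sublevel sets of the convex functions [|x|] and [|y| + r * |x|]. *)
Lemma under_curve_convex (g1 g2 : R -> R) (lo hi h : R) :
  lo < hi -> hi < h ->
  (forall k, k < h -> continuous g1 k) -> (forall k, k < h -> continuous g2 k) ->
  (forall k, lo <= k <= hi -> 0 < g1 k) -> (forall k, lo <= k <= hi -> 0 < g2 k) ->
  (forall k k', lo <= k -> k <= k' -> k' <= hi ->
     g2 k' / g1 k' <= g2 k / g1 k) ->
  convex_toric_domain (toric_domain (under_curve g1 g2 lo hi)).
Proof.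
intros Hlo Hhi C1 C2 P1 P2 Mon.
set (a := RInt g1 lo hi).
set (r k := g2 k / g1 k).
set (q k := RInt g2 lo k + r k * RInt g1 k hi).
assert (Hr : forall k, lo <= k <= hi -> 0 < r k)
  by (intros; apply Rdiv_lt_0_compat; auto).
assert (Mon' : forall k k', lo <= k -> k <= k' -> k' <= hi ->
  -1 * (g2 k / g1 k) <= -1 * (g2 k' / g1 k'))
  by (intros k k' H1 H2 H3; specialize (Mon k k' H1 H2 H3); lra).
assert (Hat : forall z, hat (under_curve g1 g2 lo hi) z <->
  Rabs (fst z) <= a /\
  forall k, lo <= k <= hi -> Rabs (snd z) + r k * Rabs (fst z) <= q k).
{ intros [x y]; unfold hat, under_curve; simpl.
  split.
  - intros [[Hx0 Hx] [k [Hk [Eq Hy]]]]; split; [exact Hx |].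
    intros j Hj.
    assert (T := tangent_side g1 g2 lo hi h (-1) Hhi C1 C2 P1 Mon' j k Hj Hk).
    fold (r j) in T; unfold q; rewrite Eq; lra.
  - intros [Hx Hy]; assert (X0 := Rabs_pos x); assert (Y0 := Rabs_pos y).
    split; [split; assumption |].
    destruct (under_curve_param g1 lo hi h Hlo Hhi C1 (Rabs x)) as [k [Hk Eq]];
      [split; assumption |].
    exists k; split; [exact Hk |]; split; [symmetry; exact Eq |].
    specialize (Hy k Hk); unfold q in Hy; rewrite Eq in Hy; lra. }
exists (under_curve g1 g2 lo hi).
split; [apply under_curve_in_quadrant |]; split; [tauto |]; split.
- apply (compact_of_closed_bounded _ a (q lo)).
  + apply (closed_ext (T := prod_UniformSpace R_UniformSpace R_UniformSpace)
      (fun z => Rabs (fst z) <= a /\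
         forall k, lo <= k <= hi -> Rabs (snd z) + r k * Rabs (fst z) <= q k));
      [intros z; symmetry; apply Hat |].
    assert (CX : forall z : prod_UniformSpace R_UniformSpace R_UniformSpace,
      continuous (fun z => Rabs (fst z)) z).
    { intros [x y]; apply (continuous_comp fst Rabs);
        [apply continuous_fst | apply continuous_Rabs]. }
    assert (CY : forall z : prod_UniformSpace R_UniformSpace R_UniformSpace,
      continuous (fun z => Rabs (snd z)) z).
    { intros [x y]; apply (continuous_comp snd Rabs);
        [apply continuous_snd | apply continuous_Rabs]. }
    apply closed_and; [apply closed_le_const, CX |].
    intros z Hz k Hk.
    apply (closed_le_const (fun z => Rabs (snd z) + r k * Rabs (fst z)) (q k)).
    * intros y; apply (continuous_plus (V := R_NormedModule)); [apply CY |].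
      apply (continuous_scal_r (V := R_NormedModule) (r k)), CX.
    * intros L; apply Hz; revert L; apply filter_imp; intros y Hy H.
      apply Hy, H, Hk.
  + intros z Hz; apply Hat in Hz; destruct Hz as [Hx Hy].
    split; apply Rabs_le_between; [exact Hx |].
    specialize (Hy lo ltac:(lra)).
    assert (0 <= r lo * Rabs (fst z))
      by (apply Rmult_le_pos; [apply Rlt_le, Hr; lra | apply Rabs_pos]).
    lra.
- intros x y t Ax Ay Ht; apply Hat in Ax; apply Hat in Ay; apply Hat; simpl.
  destruct Ax as [Ax1 Ax2]; destruct Ay as [Ay1 Ay2].
  assert (F := Rabs_convex (fst x) (fst y) t Ht).
  assert (S := Rabs_convex (snd x) (snd y) t Ht).
  split; [nra |].
  intros k Hk; specialize (Ax2 k Hk); specialize (Ay2 k Hk).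
  apply (Rmult_le_compat_l (r k)) in F; [| apply Rlt_le, Hr, Hk].
  nra.
Qed.

(** * The toric domain of the Euler problem *)

Lemma continuous_orbit_time (E M k : R) :
  0 < E -> 2 * k < E -> 0 < discr E M k -> continuous (orbit_time E M) k.
Proof.
intros HE Hk Hd; apply (ex_derive_continuous (orbit_time E M)).
eexists; apply is_derive_orbit_time; assumption.
Qed.

(** At [kappa = M1 / 2] the two discriminants are [(E - M1)^2] and
    [(E - M1)^2 - 4 * m1 * m2], and [c < c0] says that
    [E - (m1 + |m2|) > 2 * sqrt (m1 * |m2|)].  So both are positive there, hence
    also slightly beyond. *)
Lemma subcritical (m1 m2 c : R) :
  0 < m1 -> Rabs m2 <= m1 -> c < c0 m1 m2 ->
  0 <= M1 m1 m2 < - c /\ 0 <= M2 m1 m2 /\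
  exists h, M1 m1 m2 / 2 < h /\ forall k, k < h ->
    2 * k < - c /\ 0 < discr (- c) (M1 m1 m2) k
    /\ 0 < discr (- c) (M2 m1 m2) k.
Proof.
intros Hm1 Hm Hc.
assert (P := sqrt_pos m1); assert (Q := sqrt_pos (Rabs m2)).
assert (PP := sqrt_sqrt m1 (Rlt_le _ _ Hm1)).
assert (QQ := sqrt_sqrt _ (Rabs_pos m2)).
unfold c0 in Hc; unfold M1, M2.
set (p := sqrt m1) in *; set (q := sqrt (Rabs m2)) in *; set (E := - c).
assert (HE : m1 + Rabs m2 + 2 * (p * q) < E)
  by (rewrite <- PP, <- QQ; unfold E; lra).
assert (PQ : 0 <= p * q) by (apply Rmult_le_pos; assumption).
assert (Habs : - Rabs m2 <= m2 <= Rabs m2) by (apply Rabs_le_between; lra).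
assert (D1 : 0 < discr E (m1 + m2) ((m1 + m2) / 2)).
{ unfold discr.
  replace (E^2 - 4 * E * ((m1 + m2) / 2) + (m1 + m2)^2)
    with ((E - (m1 + m2))^2) by field.
  apply pow_lt; lra. }
assert (D2 : 0 < discr E (m1 - m2) ((m1 + m2) / 2)).
{ unfold discr.
  replace (E^2 - 4 * E * ((m1 + m2) / 2) + (m1 - m2)^2)
    with ((E - (m1 + m2))^2 - 4 * (m1 * m2)) by field.
  assert (Z : 4 * (m1 * m2) <= (2 * (p * q))^2).
  { replace ((2 * (p * q))^2) with (4 * (p * p * (q * q))) by ring.
    rewrite PP, QQ.
    apply Rmult_le_compat_l; [lra |]; apply Rmult_le_compat_l; lra. }
  nra. }
split; [lra |]; split; [lra |].
assert (A1 := locally_admissible E (m1 + m2) ((m1 + m2) / 2)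
                ltac:(lra) ltac:(lra) D1).
assert (A2 := locally_admissible E (m1 - m2) ((m1 + m2) / 2)
                ltac:(lra) ltac:(lra) D2).
destruct (filter_and _ _ A1 A2) as [e He].
assert (He0 := cond_pos e).
exists ((m1 + m2) / 2 + e / 2); split; [lra |].
intros k Hk.
destruct (He ((m1 + m2) / 2 + e / 2)) as [[H1 H2] [_ H3]].
{ apply Rabs_def1; unfold minus, plus, opp; simpl; lra. }
unfold discr in *; repeat split; nra.
Qed.

Lemma T2_integral (m1 m2 c k : R) :
  0 < m1 -> Rabs m2 <= m1 -> c < c0 m1 m2 ->
  - M2 m1 m2 / 2 <= k <= M1 m1 m2 / 2 ->
  T2 m1 m2 c k = RInt (orbit_time (- c) (M2 m1 m2)) (- M2 m1 m2 / 2) k.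
Proof.
intros Hm1 Hm Hc Hk.
destruct (subcritical m1 m2 c Hm1 Hm Hc) as [_ [_ [h [Hh Adm]]]].
apply RInt_ext; intros x; rewrite Rmin_left, Rmax_right by lra; intros Hx.
destruct (Adm x ltac:(lra)) as [A1 [_ A2]].
apply tau2_orbit_time; lra.
Qed.

Lemma T1_integral (m1 m2 c k : R) :
  0 < m1 -> Rabs m2 <= m1 -> c < c0 m1 m2 ->
  - M2 m1 m2 / 2 <= k <= M1 m1 m2 / 2 ->
  T1 m1 m2 c (- k) = RInt (orbit_time (- c) (M1 m1 m2)) k (M1 m1 m2 / 2).
Proof.
intros Hm1 Hm Hc Hk.
destruct (subcritical m1 m2 c Hm1 Hm Hc) as [HM1 [HM2 [h [Hh Adm]]]].
set (g := orbit_time (- c) (M1 m1 m2)).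
assert (Cg : forall x, x < h -> continuous g x).
{ intros x Hx; destruct (Adm x Hx) as [A1 [A2 _]].
  apply continuous_orbit_time; lra. }
assert (Ex : ex_RInt g (-1 * (- M1 m1 m2 / 2) + 0) (-1 * (- k) + 0))
  by (apply ex_RInt_continuous_lt with h; [exact Cg | lra | lra]).
assert (Swap := RInt_comp_lin g (-1) 0 (- M1 m1 m2 / 2) (- k) Ex).
replace (-1 * (- M1 m1 m2 / 2) + 0) with (M1 m1 m2 / 2) in Swap by field.
replace (-1 * (- k) + 0) with k in Swap by ring.
assert (Loop := RInt_split g h k (M1 m1 m2 / 2) k Cg
                  ltac:(lra) ltac:(lra) ltac:(lra)).
rewrite RInt_self in Loop.
replace (RInt g k (M1 m1 m2 / 2)) with (-1 * RInt g (M1 m1 m2 / 2) k) by lra.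
rewrite <- Swap, <- RInt_mult_l.
- apply RInt_ext; intros b; rewrite Rmin_left, Rmax_right by lra; intros Hb.
  replace b with (- - b) at 1 by ring.
  rewrite tau1_orbit_time by lra.
  unfold scal; simpl; unfold mult; simpl.
  replace (-1 * b + 0) with (- b) by ring; fold g; ring.
- apply (ex_RInt_comp_lin (V := R_NormedModule)).
  apply ex_RInt_continuous_lt with h; [exact Cg | lra | lra].
Qed.

Lemma Omega_e_under_curve (m1 m2 c : R) :
  0 < m1 -> Rabs m2 <= m1 -> c < c0 m1 m2 ->
  forall rho, Omega_e m1 m2 c rho <->
    under_curve (orbit_time (- c) (M1 m1 m2)) (orbit_time (- c) (M2 m1 m2))
      (- M2 m1 m2 / 2) (M1 m1 m2 / 2) rho.
Proof.
intros Hm1 Hm Hc [x y].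
assert (I2 := fun k => T2_integral m1 m2 c k Hm1 Hm Hc).
assert (I1 := fun k => T1_integral m1 m2 c k Hm1 Hm Hc).
assert (Ia : T1 m1 m2 c (M2 m1 m2 / 2)
  = RInt (orbit_time (- c) (M1 m1 m2)) (- M2 m1 m2 / 2) (M1 m1 m2 / 2)).
{ rewrite <- I1; [f_equal; field |]; unfold M1, M2; lra. }
unfold Omega_e, under_curve; simpl; rewrite Ia.
split; intros [Hx H]; split; try exact Hx.
- destruct H as [y' [[k [Hk Eq]] Hy]]; injection Eq; intros -> ->.
  exists k; rewrite <- I1, <- I2 by exact Hk; auto.
- destruct H as [k [Hk [-> Hy]]].
  exists (RInt (orbit_time (- c) (M2 m1 m2)) (- M2 m1 m2 / 2) k).
  split; [| exact Hy].
  exists k; rewrite I1, I2 by exact Hk; auto.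
Qed.

Theorem corollaryB (m1 m2 c : R)
  (hm1 : 0 < m1) (hm : Rabs m2 <= m1) (hc : c < c0 m1 m2) :
  (0 <= m2 -> concave_toric_domain (toric_domain (Omega_e m1 m2 c))) /\
  (m2 <= 0 -> convex_toric_domain (toric_domain (Omega_e m1 m2 c))).
Proof.
destruct (subcritical m1 m2 c hm1 hm hc) as [HM1 [HM2 [h [Hh Adm]]]].
assert (Equiv := Omega_e_under_curve m1 m2 c hm1 hm hc).
set (g1 := orbit_time (- c) (M1 m1 m2)) in *.
set (g2 := orbit_time (- c) (M2 m1 m2)) in *.
assert (Hlo : - M2 m1 m2 / 2 < M1 m1 m2 / 2) by (unfold M1, M2; lra).
assert (HE : 0 < - c) by lra.
assert (C1 : forall k, k < h -> continuous g1 k)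
  by (intros k Hk; destruct (Adm k Hk) as [A [A1 A2]];
      apply continuous_orbit_time; assumption).
assert (C2 : forall k, k < h -> continuous g2 k)
  by (intros k Hk; destruct (Adm k Hk) as [A [A1 A2]];
      apply continuous_orbit_time; assumption).
assert (P1 : forall k, - M2 m1 m2 / 2 <= k <= M1 m1 m2 / 2 -> 0 < g1 k)
  by (intros k Hk; destruct (Adm k ltac:(lra)) as [A [A1 A2]];
      apply orbit_time_pos; assumption).
assert (P2 : forall k, - M2 m1 m2 / 2 <= k <= M1 m1 m2 / 2 -> 0 < g2 k)
  by (intros k Hk; destruct (Adm k ltac:(lra)) as [A [A1 A2]];
      apply orbit_time_pos; assumption).
split; intros Hm2.
- destruct (under_curve_concave g1 g2 (- M2 m1 m2 / 2) (M1 m1 m2 / 2) h)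
    as [Om [HOm [Eq R]]]; try assumption.
  + intros k k' H1 H2 H3; destruct (Adm k' ltac:(lra)) as [A [A1 A2]].
    apply orbit_time_ratio_monotone; try assumption.
    unfold M1, M2; nra.
  + exists Om; split; [exact HOm |]; split; [| exact R].
    intros z; rewrite <- Eq; apply Equiv.
- destruct (under_curve_convex g1 g2 (- M2 m1 m2 / 2) (M1 m1 m2 / 2) h)
    as [Om [HOm [Eq R]]]; try assumption.
  + intros k k' H1 H2 H3; destruct (Adm k' ltac:(lra)) as [A [A1 A2]].
    assert (Mon : g1 k / g2 k <= g1 k' / g2 k').
    { apply orbit_time_ratio_monotone; try assumption.
      unfold M1, M2; nra. }
    assert (Q1 := P1 k ltac:(lra)); assert (Q2 := P2 k ltac:(lra)).
    assert (Q1' := P1 k' ltac:(lra)); assert (Q2' := P2 k' ltac:(lra)).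
    replace (g2 k / g1 k) with (/ (g1 k / g2 k)) by (field; lra).
    replace (g2 k' / g1 k') with (/ (g1 k' / g2 k')) by (field; lra).
    apply Rinv_le_contravar; [apply Rdiv_lt_0_compat | exact Mon]; assumption.
  + exists Om; split; [exact HOm |]; split; [| exact R].
    intros z; rewrite <- Eq; apply Equiv.
Qed.
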